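(* Let $W$ be the Whitehead link in $S^3$, let $\tau_W$ be the torsion function on the variety $X^{\rm irr}(S^3-W)$ of irreducible $\mathrm{SL}_2(\mathbb{C})$-characters of $W$, and let $W(-3,-3)$ be the result of the $(-3,-3)$-surgery along $W$. Regard $X^{\rm irr}(W(-3,-3))$ as a $1$-dimensional irreducible subvariety of $X^{\rm irr}(S^3-W)$. Then the divisor $D(\tau_W)$ of $\tau_W$ on $X^{\rm irr}(S^3-W)$ satisfies $$D(\tau_W)=2\,X^{\rm irr}(W(-3,-3)).$$
   Context: Characters. For a compact manifold $M$, $X(M)$ is the $\mathrm{SL}_2(\mathbb{C})$-character variety, i.e. the affine algebraic set of characters $\mathrm{Tr}\,\rho$ of representations $\rho:\pi_1(M)\to \mathrm{SL}_2(\mathbb{C})$, and $X^{\rm irr}(M)\subset X(M)$ is the Zariski open subset of characters of irreducible representations. For a link $L$, $S^3-L$ denotes its exterior. Torsion. For a compact connected 3-manifold $M$ and $\rho:\pi_1(M)\to \mathrm{SL}_2(\mathbb{C})$, put $C_*(M,\rho)=\mathbb{C}^2\otimes_{\mathbb{Z}[\pi_1(M)]}C_*(\widetilde M)$, where $\widetilde M$ is the universal cover with lifted CW structure and $\mathbb{C}^2$ is a right module via $g\mapsto\rho(g^{-1})$. $\rho$ is acyclic if all $H_i(M,\rho)=H_i(C_*(M,\rho))$ vanish. The Reidemeister torsion of an acyclic $\rho$ is, up to sign, $\prod_i[\mathfrak b_i\sqcup\widetilde{\mathfrak b}_{i-1}:\mathfrak c_i]^{(-1)^{i+1}}$, where $\mathfrak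 c_i$ is the basis of $C_i(M,\rho)$ given by a basis of $\mathbb{C}^2$ tensored with lifts of the cells, $\mathfrak b_i$ is a basis of the image of $\partial_{i+1}$, $\widetilde{\mathfrak b}_{i-1}$ is a lift of $\mathfrak b_{i-1}$ to $C_i(M,\rho)$, and $[\,:\,]$ is the determinant of the transition matrix. The torsion function is the rational function on the character variety taking these values at acyclic characters. Whitehead link. $\pi_1(S^3-W)=\langle m,\mu\mid mw=wm\rangle$ with $w=\mu m\mu^{-1}m^{-1}\mu^{-1}m\mu$, where $m,\mu$ are meridians of the two components. With $x=\mathrm{Tr}\,m$, $y=\mathrm{Tr}\,\mu$, $z=\mathrm{Tr}\,m\mu$, $f_1=xyz^2-z(x^2+y^2+z^2)+xy+2z$ and $g=x^2+y^2+z^2-xyz-4$, one has $X(S^3-W)=\{f_1g=0\}\subset\mathbb{C}^3$ and $X^{\rm irr}(S^3-W)=\{f_1=0\}\setminus\{g=0\}$. It is known that $\tau_W(x,y,z)=2(2+z-x-y)$. Surgery. With $a=m\mu$, $b=m^2\mu$, peripheral (meridian, longitude) pairs of the two components are $\mu'=a^{-2}b$, $\lambda'=a^{-2}bab^{-2}ab$ and $m'=b^{-1}a$, $\ell'=b^{-1}ab^{-1}aba^{-3}ba$. The $p/q$-filling along a component kills $(\text{meridian})^p(\text{longitude})^q$; so $\pi_1(W(-3,-3))$ is the quotient of $\pi_1(S^3-W)$ by $\mu'^3=\lambda'$ and $m'^3=\ell'$, and $X^{\rm irr}(W(-3,-3))$ is embedded in $X^{\rm irr}(S^3-W)$ by composing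 with this quotient map. Divisor. For a regular function $P$ on a smooth variety $X$ with $X\cap\{P=0\}=C_1\cup\dots\cup C_r$ the irreducible decomposition, $D(P)=\sum_i m_iC_i$, where $m_i$ is the order of vanishing (valuation of $P$ in the local ring of $X$ along $C_i$). *)

(* Defs.v *)
From mathcomp Require Export all_boot all_order all_algebra.
From mathcomp Require Export boolp classical_sets reals.
From mathcomp Require Export complex.
From mathcomp Require Export freeg mpoly.

Set Implicit Arguments.
Unset Strict Implicit.
Unset Printing Implicit Defensive.

Import Order.TTheory GRing.Theory Num.Theory.

Local Open Scope classical_set_scope.
Local Open Scope ring_scope.

(** ** Words, finite presentations and Fox calculus *)

(* A letter (i, false) is the generator x_i, and (i, true) is its inverse. *)
Definition word (n : nat) := seq ('I_n * bool).

Definition gen n (i : 'I_n) : word n := [:: (i, false)].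

Definition winv n (w : word n) : word n := rev [seq (x.1, ~~ x.2) | x <- w].

Definition wpow n (w : word n) (k : int) : word n :=
  match k with
  | Posz j => flatten (nseq j w)
  | Negz j => flatten (nseq j.+1 (winv w))
  end.

(* The list of relators; the presented group is <x_0, ..., x_(n-1) | P>. *)
Definition presentation (n : nat) := seq (word n).

(* Formal Z-linear combinations of words. *)
Definition zword (n : nat) := seq (int * word n).

(* d(uv) = du + u dv,  d x_j = 1,  d x_j^-1 = - x_j^-1 *)
Fixpoint fox n (j : 'I_n) (w : word n) : zword n :=
  match w with
  | [::] => [::]
  | (i, e) :: v =>
      (if i == j then
         [:: if e then (-1, [:: (i, true)]) else (1, [::])] else [::])
      ++ [seq (c.1, (i, e) :: c.2) | c <- fox j v]
  end.

(** ** SL_2-representations of a presented group *)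

Section Representations.
Variables (F : fieldType) (n : nat).
Implicit Types (rho : 'I_n -> 'M[F]_2) (P : presentation n).

Fixpoint word_mx rho (w : word n) : 'M[F]_2 :=
  match w with
  | [::] => 1%:M
  | (i, e) :: v => (if e then invmx (rho i) else rho i) *m word_mx rho v
  end.

(* A homomorphism from the presented group to SL_2(F), given by the images of
   the generators. *)
Definition is_rep P rho : Prop :=
  (forall i, \det (rho i) = 1) /\ (forall w, w \in P -> word_mx rho w = 1%:M).

Definition irreducible_rep rho : Prop :=
  ~ exists v : 'cV[F]_2,
      v != 0 /\ forall w, exists c : F, word_mx rho w *m v = c *: v.

Definition character rho (w : word n) : F := \tr (word_mx rho w).

(* The action of Z[F_n] on F^2 for which g acts by rho(g^-1). *)
Definition dual_action rho (z : zword n) : 'M[F]_2 :=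
  \sum_(c <- z) word_mx rho (winv c.2) *~ c.1.

End Representations.

(** ** Reidemeister torsion of a based chain complex *)

(* The complex ... -> C_1 -> C_0 has C_i = 'rV_(d i) with its standard basis,
   and bd i : C_(i+1) -> C_i acts on row vectors by right multiplication. *)
Section Torsion.
Variables (F : fieldType) (d : nat -> nat).
Variable bd : forall i, 'M[F]_(d i.+1, d i).

Definition acyclic : Prop :=
  row_full (bd 0) /\ forall i, (kermx (bd i) == bd i.+1)%MS.

(* The family b_i, followed by the lift of b_(i-1); b_(-1) is empty. *)
Definition adapted_basis (r : nat -> nat) (b : forall i, 'M[F]_(r i, d i))
    (b' : forall i, 'M[F]_(r i, d i.+1)) (i : nat) :
    'M[F]_(match i with 0 => r 0 | j.+1 => r j.+1 + r j end, d i) :=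
  match i with
  | 0 => b 0
  | j.+1 => col_mx (b j.+1) (b' j)
  end.

(* The determinant of a family of k vectors in F^m with respect to the standard
   basis; conform_mx is the identity when k = m, which always holds below for
   adapted bases of acyclic complexes. *)
Definition transition_det (k m : nat) (B : 'M[F]_(k, m)) : F :=
  \det (conform_mx (0 : 'M[F]_m) B).

(* t is a value of the torsion computed in degrees 0, ..., N. *)
Definition torsion_value (N : nat) (t : F) : Prop :=
  exists (r : nat -> nat) (b : forall i, 'M[F]_(r i, d i))
         (b' : forall i, 'M[F]_(r i, d i.+1)),
  [/\ forall i, row_free (b i) /\ (b i == bd i)%MS,
      forall i, b' i *m bd i = b i
    & t = \prod_(i < N.+1)
            transition_det (adapted_basis b b' i) ^ ((-1) ^+ i.+1 : int)].

End Torsion.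

(** ** The twisted chain complex of a presentation 2-complex *)

Section PresentationComplex.
Variables (F : fieldType) (n : nat) (P : presentation n).
Variable rho : 'I_n -> 'M[F]_2.

Definition cells (i : nat) : nat :=
  match i with 0 => 1 | 1 => n | 2 => size P | _ => 0 end.

(* Incidence coefficients between the lifted cells in the universal cover:
   x_a - 1 in degree 1 and the Fox derivatives of the relators in degree 2. *)
Definition incidence (i : nat) : 'I_(cells i.+1) -> 'I_(cells i) -> zword n :=
  match i return 'I_(cells i.+1) -> 'I_(cells i) -> zword n with
  | 0 => fun a _ => [:: (1, gen a); (-1, [::])]
  | 1 => fun a c => fox c (nth [::] P a)
  | _ => fun _ _ => [::]
  end.

Definition twisted_dim (i : nat) : nat := (\sum_(a < cells i) 2)%N.

(* Transposed blocks, as coordinates are row vectors while rho acts on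
   columns. *)
Definition twisted_bd (i : nat) : 'M[F]_(twisted_dim i.+1, twisted_dim i) :=
  \mxblock_(a < cells i.+1, c < cells i) (dual_action rho (incidence a c))^T.

Definition acyclic_rep : Prop := acyclic twisted_bd.

Definition rep_torsion (t : F) : Prop := torsion_value twisted_bd 2 t.

End PresentationComplex.

(** ** Quasi-affine varieties in F^n, as sets of points *)

Section Varieties.
Variables (F : fieldType) (n : nat).
Notation pt := 'rV[F]_n.
Implicit Types (X Y Z C : set pt) (phi psi t u : pt -> F).

Definition ev (p : {mpoly F[n]}) (v : pt) : F := p.@[fun i => v 0 i].

Definition closed_in X Z : Prop :=
  exists S : set {mpoly F[n]},
    Z = X `&` [set v | forall p, S p -> ev p v = 0].

Definition irreducible_set Z : Prop :=
  Z !=set0 /\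
  forall A B, closed_in Z A -> closed_in Z B ->
    Z `<=` A `|` B -> Z `<=` A \/ Z `<=` B.

Definition subvariety X Y : Prop := closed_in X Y /\ irreducible_set Y.

Definition irreducible_component Z C : Prop :=
  subvariety Z C /\ forall C', subvariety Z C' -> C `<=` C' -> C' = C.

Definition subvariety_chain Z (e : nat) (c : 'I_e.+1 -> set pt) : Prop :=
  (forall i, subvariety Z (c i)) /\
  (forall i j : 'I_e.+1, (i < j)%N -> c i `<=` c j /\ c i <> c j).

(* Krull dimension *)
Definition has_dimension Z (e : nat) : Prop :=
  (exists c : 'I_e.+1 -> set pt, subvariety_chain Z c) /\
  (forall e' (c : 'I_e'.+1 -> set pt), subvariety_chain Z c -> (e' <= e)%N).

Definition regular_on X phi : Prop :=
  forall v, X v -> exists f h, ev h v != 0 /\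
    forall w, X w -> ev h w != 0 -> phi w = ev f w / ev h w.

(** The local ring O_(X,C) of X along a subvariety C.  Its elements are
    represented by functions that are regular on an open subset of X meeting C;
    two of them are the same germ when they agree on such an open subset. *)

(* Q holds on X \ {h = 0} for some h that does not vanish identically on C. *)
Definition generically X C (Q : pt -> Prop) : Prop :=
  exists h, (exists2 v, C v & ev h v != 0) /\
    forall w, X w -> ev h w != 0 -> Q w.

Definition germ X C phi : Prop :=
  exists f h, (exists2 v, C v & ev h v != 0) /\
    forall w, X w -> ev h w != 0 -> phi w = ev f w / ev h w.

Definition germ_eq X C phi psi : Prop :=
  generically X C (fun w => phi w = psi w).

Definition germ_max X C phi : Prop :=
  germ X C phi /\ generically X C (fun w => C w -> phi w = 0).

Definition germ_unit X C phi : Prop := germ X C phi /\ ~ germ_max X C phi.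

(* A non-zero generator of the maximal ideal.  The local ring being noetherian
   and reduced, such a t exists only if it is a discrete valuation ring. *)
Definition uniformizer X C t : Prop :=
  [/\ germ_max X C t,
      ~ germ_eq X C t (fun=> 0)
    & forall phi, germ_max X C phi ->
        exists2 psi, germ X C psi & germ_eq X C phi (fun w => psi w * t w)].

(* The valuation of phi in the local ring of X along C is k. *)
Definition vanishing_order X C phi (k : nat) : Prop :=
  exists t u, [/\ uniformizer X C t, germ_unit X C u
    & germ_eq X C phi (fun w => u w * t w ^+ k)].

(* D is the divisor of phi on X: its coefficient along an irreducible component
   of the zero locus is the order of vanishing, and it has no other terms. *)
Definition is_divisor X phi (D : {freeg (set pt) / int}) : Prop :=
  forall Z,
    (irreducible_component (X `&` [set v | phi v = 0]) Z ->
       exists2 k : nat, vanishing_order X Z phi k & coeff Z D = k%:Z) /\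
    (~ irreducible_component (X `&` [set v | phi v = 0]) Z ->
       coeff Z D = 0).

End Varieties.

(** ** The Whitehead link *)

Section Whitehead.

Definition wl_m : word 2 := gen ord0.
Definition wl_mu : word 2 := gen ord_max.

Let m := wl_m.
Let u := wl_mu.

Definition wl_w : word 2 :=
  u ++ m ++ winv u ++ winv m ++ winv u ++ m ++ u.

Definition whitehead : presentation 2 :=
  [:: m ++ wl_w ++ winv m ++ winv wl_w].

Definition wl_a : word 2 := m ++ u.
Definition wl_b : word 2 := wpow m 2 ++ u.

Let a := wl_a.
Let b := wl_b.

Definition meridian1 : word 2 := wpow a (-2) ++ b.
Definition longitude1 : word 2 := wpow a (-2) ++ b ++ a ++ wpow b (-2) ++ a ++ b.
Definition meridian2 : word 2 := winv b ++ a.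
Definition longitude2 : word 2 :=
  winv b ++ a ++ winv b ++ a ++ b ++ wpow a (-3) ++ b ++ a.

(* Fundamental group of the (p1/q1, p2/q2)-surgery. *)
Definition whitehead_surgery (p1 q1 p2 q2 : int) : presentation 2 :=
  whitehead ++ [:: wpow meridian1 p1 ++ wpow longitude1 q1;
                   wpow meridian2 p2 ++ wpow longitude2 q2].

Variable F : fieldType.

(* The coordinates (x, y, z) = (Tr m, Tr mu, Tr m mu), which determine the
   character of a representation of a quotient of the free group on m, mu. *)
Definition char_pt (rho : 'I_2 -> 'M[F]_2) : 'rV[F]_3 :=
  \row_(i < 3) [:: character rho m; character rho u; character rho (m ++ u)]`_i.

Definition Xirr (P : presentation 2) : set 'rV[F]_3 :=
  [set v | exists rho, [/\ is_rep P rho, irreducible_rep rho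
                         & v = char_pt rho]].

(* The presentation 2-complex of [whitehead] is used as a CW model of the
   exterior (the exterior of this two-bridge link collapses onto it); torsion
   values are only defined up to sign. *)
Definition torsion_function (tau : 'rV[F]_3 -> F) : Prop :=
  regular_on (Xirr whitehead) tau /\
  forall rho, is_rep whitehead rho -> irreducible_rep rho ->
    acyclic_rep whitehead rho ->
    forall t, rep_torsion whitehead rho t ->
      tau (char_pt rho) = t \/ tau (char_pt rho) = - t.

End Whitehead.

Arguments Xirr F P : clear implicits.
Arguments torsion_function F tau : clear implicits.

(* Main.v *)
Require Import Defs.
From mathcomp Require Import ring.

Set Implicit Arguments.
Unset Strict Implicit.
Unset Printing Implicit Defensive.

Import Order.TTheory GRing.Theory Num.Theory.

Local Open Scope classical_set_scope.
Local Open Scope ring_scope.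

(** An irreducible representation is determined up to conjugation by
    (x, y, z) = (Tr m, Tr mu, Tr m mu), and every word in m and mu is a
    combination of 1, m, mu, m mu whose coefficients are polynomials in
    x, y, z.  In these coordinates the mu-coefficient of w is the polynomial
    [riley], and the (m mu)-coefficient vanishes, so m and w commute exactly
    when [riley] is zero: the irreducible characters of the link form the
    surface riley = 0 minus the reducible locus g = 0
    ([Xirr_whiteheadP]).

    Cancelling letters, the two surgery relations say that a = m mu and
    b = m^2 mu satisfy a^3 = b^3 = 1 ([surgery_relators]).  For non-scalar
    matrices in SL_2 this means that a and b have trace -1, that is z = -1 and
    x + y = 1.  This line lies on riley = 0, so the characters of the surgery
    are the line minus its two points on g = 0 ([Xirr_surgeryP]).

    The torsion is a quotient of two determinants.  The denominator can be
    taken to be det (h - 1) = 2 - Tr h for h = m, mu or m mu, at least one of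
    which is nonzero at an irreducible character, and the numerator is then
    2 (2 + z - x - y) (2 - Tr h) ([whitehead_torsionE]); the complex is
    acyclic as soon as 2 + z - x - y is nonzero ([whitehead_acyclic]).

    Finally,
      riley = (x + y - 1)^2 (x - 2) (y - 2) + (2 + z - x - y) H
    with H = -2 on the line ([riley_along_curve]).  Along the line the surface
    is therefore smooth, x + y - 1 is a uniformizer, and 2 + z - x - y is a
    unit times (x + y - 1)^2; since g = -(x + y) (x - 2) (y - 2) where
    2 + z - x - y = 0, the torsion has no other zeros on the surface.

    A torsion function is prescribed only up to a sign that may change from
    point to point, and only at acyclic characters.  The rest of the proof
    recovers it along the line: the surface off the line is dense near the line,
    because of an explicit rational curve through each of its points
    ([exists_off_curve]), so that the square of a torsion function is known
    everywhere, and an element of a discrete valuation ring whose square is a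
    unit times t^4 is a unit times t^2 ([tau_order]). *)

(** * Two-by-two matrices *)

Section Matrix2.
Variable F : fieldType.
Implicit Types A B M U : 'M[F]_2.

Lemma mx2P A B :
  A 0 0 = B 0 0 -> A 0 1 = B 0 1 -> A 1 0 = B 1 0 -> A 1 1 = B 1 1 -> A = B.
Proof.
move=> e00 e01 e10 e11; apply/matrixP => i j.
have ord2 (k : 'I_2) : k = 0 \/ k = 1.
  by case: k => [[|[|//]] ?]; [left | right]; apply: val_inj.
by case: (ord2 i) => ->; case: (ord2 j) => ->.
Qed.

Lemma mul2E A B i j : (A * B) i j = A i 0 * B 0 j + A i 1 * B 1 j.
Proof.
rewrite -mulmxE mxE !big_ord_recl big_ord0 addr0.
by congr (_ * _ + A i _ * B _ j); apply: val_inj.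
Qed.

Lemma tr2E A : \tr A = A 0 0 + A 1 1.
Proof.
rewrite /mxtrace !big_ord_recl big_ord0 addr0.
by congr (_ + A _ _); apply: val_inj.
Qed.

Lemma det2E A : \det A = A 0 0 * A 1 1 - A 0 1 * A 1 0.
Proof.
rewrite (expand_det_row _ 0) !big_ord_recl big_ord0 addr0 /cofactor !det_mx11.
rewrite !mxE /= expr0 expr1 mul1r mulN1r mulrN.
by congr (A _ _ * A _ _ - A _ _ * A _ _); apply: val_inj.
Qed.

Definition mx2E := (mul2E, tr2E, det2E, mxE).

Lemma sqr_mx2 A : A * A = \tr A *: A - (\det A)%:M.
Proof. by apply: mx2P; rewrite !mx2E /=; ring. Qed.

(** The polarization of the Cayley-Hamilton identity.  It expresses B A through
    A B, which is why 1, A, B, A B span the algebra generated by A and B. *)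
Lemma anticomm_mx2 A B :
  A * B + B * A =
    \tr B *: A + \tr A *: B + (\tr (A * B) - \tr A * \tr B)%:M.
Proof. by apply: mx2P; rewrite !mx2E /=; ring. Qed.

Lemma sl2_unit A : \det A = 1 -> A \is a GRing.unit.
Proof. by move=> dA; rewrite unitmxE dA unitr1. Qed.

Lemma sl2_inv A : \det A = 1 -> A^-1 = (\tr A)%:M - A.
Proof.
move=> dA.
have uA := sl2_unit dA.
apply: (mulrI uA); rewrite divrr // mulrBr sqr_mx2 dA.
by rewrite -mulmxE mul_mx_scalar opprB addrCA subrr addr0.
Qed.

Lemma det_subr1 A : \det A = 1 -> \det (A - 1) = 2 - \tr A.
Proof.
move=> dA; have -> : \det (A - 1) = \det A + 1 - \tr A.
  by rewrite !mx2E /=; ring.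
by rewrite dA.
Qed.

End Matrix2.

(** * The algebra generated by two elements of SL_2 *)

(** The equation f_1 of the surface of irreducible characters. *)
Definition riley (F : fieldType) (x y z : F) : F :=
  x * y * z ^+ 2 - z * (x ^+ 2 + y ^+ 2 + z ^+ 2) + x * y + 2 * z.

(** Tr [m, mu] - 2 as a polynomial in the traces. *)
Definition reducible_locus (F : fieldType) (x y z : F) : F :=
  x ^+ 2 + y ^+ 2 + z ^+ 2 - x * y * z - 4.

Definition torsion_poly (F : fieldType) (x y z : F) : F := 2 * (2 + z - x - y).

Section Lin4.
Variables (F : fieldType) (M U : 'M[F]_2).
Hypotheses (detM : \det M = 1) (detU : \det U = 1).

Let x := \tr M.
Let y := \tr U.
Let z := \tr (M * U).

(** Coordinates on the algebra generated by M and U.  They turn identities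
    between noncommutative words into identities between polynomials in the
    traces x, y, z, uniformly in the representation. *)
Definition lin4 (a b c d : F) : 'M[F]_2 :=
  a%:M + b *: M + c *: U + d *: (M * U).

Lemma lin4_M : M = lin4 0 1 0 0.
Proof. by rewrite /lin4 !scale0r scale1r raddf0 add0r !addr0. Qed.

Lemma lin4_1 : 1 = lin4 1 0 0 0.
Proof. by rewrite /lin4 !scale0r !addr0. Qed.

Lemma lin4D a b c d a' b' c' d' :
  lin4 a b c d + lin4 a' b' c' d' = lin4 (a + a') (b + b') (c + c') (d + d').
Proof. by apply: mx2P; rewrite !mx2E /=; ring. Qed.

Lemma lin4N a b c d : - lin4 a b c d = lin4 (- a) (- b) (- c) (- d).
Proof. by apply: mx2P; rewrite !mx2E /=; ring. Qed.

Lemma lin4Z k a b c d :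
  k *: lin4 a b c d = lin4 (k * a) (k * b) (k * c) (k * d).
Proof. by apply: mx2P; rewrite !mx2E /=; ring. Qed.

Lemma lin4_mulM a b c d :
  M * lin4 a b c d = lin4 (- b) (a + x * b) (- d) (c + x * d).
Proof.
have -> : M * lin4 a b c d =
    a *: M + b *: (M * M) + c *: (M * U) + d *: (M * M * U).
  by apply: mx2P; rewrite !mx2E /=; ring.
by rewrite sqr_mx2 detM /lin4 -/x; apply: mx2P; rewrite !mx2E /=; ring.
Qed.

Lemma lin4_mulU a b c d :
  U * lin4 a b c d = lin4 (b * (z - x * y) - c - x * d) (b * y + d)
                          (a + b * x + c * y + d * z) (- b).
Proof.
have UM : U * M = y *: M + x *: U + (z - x * y)%:M - M * U.
  by rewrite -anticomm_mx2 addrAC subrr add0r.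
have -> : U * lin4 a b c d =
    a *: U + b *: (U * M) + c *: (U * U) + d *: (U * M * U).
  by apply: mx2P; rewrite !mx2E /=; ring.
have -> : U * M * U = M - x%:M + z *: U.
  rewrite UM -[M - _](addrC) -/y.
  have -> : (y *: M + x *: U + (z - x * y)%:M - M * U) * U =
     y *: (M * U) + x *: (U * U) + (z - x * y) *: U - M * (U * U).
     by apply: mx2P; rewrite !mx2E /=; ring.
  by rewrite sqr_mx2 detU -/y; apply: mx2P; rewrite !mx2E /=; ring.
by rewrite UM sqr_mx2 detU -/y /lin4; apply: mx2P; rewrite !mx2E /=; ring.
Qed.

Lemma lin4_mulMV a b c d :
  M^-1 * lin4 a b c d = lin4 (x * a + b) (- a) (x * c + d) (- c).
Proof.
rewrite (sl2_inv detM) mulrBl lin4_mulM -mulmxE mul_scalar_mx lin4Z lin4N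
  lin4D -/x.
by congr lin4; ring.
Qed.

Lemma lin4_mulUV a b c d :
  U^-1 * lin4 a b c d =
    lin4 (y * a - (b * (z - x * y) - c - x * d)) (- d)
         (- (a + b * x + d * z)) (y * d + b).
Proof.
rewrite (sl2_inv detU) mulrBl lin4_mulU -mulmxE mul_scalar_mx lin4Z lin4N
  lin4D -/y.
by congr lin4; ring.
Qed.

(** The polar form of the determinant is (A, B) |-> Tr (A adj B), so that the
    coefficients are traces of products of M and U with inverses. *)
Lemma det_lin4 a b c d :
  \det (lin4 a b c d) =
    a ^+ 2 + b ^+ 2 + c ^+ 2 + d ^+ 2 + x * (a * b + c * d)
      + y * (a * c + b * d) + z * (a * d - b * c) + x * y * (b * c).
Proof.
pose dM := \det M; pose dU := \det U.
have -> : \det (lin4 a b c d) =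
    a ^+ 2 + b ^+ 2 * dM + c ^+ 2 * dU + d ^+ 2 * dM * dU
    + x * (a * b + c * d * dU) + y * (a * c + b * d * dM)
      + z * (a * d - b * c) + x * y * (b * c).
  by rewrite /dM /dU /x /y /z !mx2E /=; ring.
by rewrite /dM /dU detM detU; ring.
Qed.

Lemma det_commutator : \det (M * U - U * M) = - reducible_locus x y z.
Proof.
pose dM := \det M; pose dU := \det U.
have -> : \det (M * U - U * M) =
    4 * dM * dU + x * y * z - x ^+ 2 * dU - y ^+ 2 * dM - z ^+ 2.
  by rewrite /dM /dU /x /y /z !mx2E /=; ring.
by rewrite /dM /dU detM detU /reducible_locus; ring.
Qed.

(** The value of the word w of the relation m w = w m. *)
Definition w_mx : 'M[F]_2 := U * (M * (U^-1 * (M^-1 * (U^-1 * (M * U))))).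

Lemma lin4_U : U = lin4 0 0 1 0.
Proof. by apply: mx2P; rewrite !mx2E /=; ring. Qed.

Lemma lin4_MU : M * U = lin4 0 0 0 1.
Proof. by apply: mx2P; rewrite !mx2E /=; ring. Qed.

(** One polynomial governs the relation m w = w m: it is the coordinate of w
    along U, and the coordinate along M U is zero. *)
Lemma w_mxE :
  w_mx = lin4 (x * z ^+ 2 - x ^+ 2 * y * z + y * z + x ^+ 3 - 2 * x)
             (x * y * z - z ^+ 2 - x ^+ 2 + 1) (riley x y z) 0.
Proof.
rewrite /w_mx /riley lin4_MU.
rewrite lin4_mulUV lin4_mulMV lin4_mulUV lin4_mulM lin4_mulU.
by congr lin4; ring.
Qed.

(** The Fox derivative of w by mu. *)
Definition w_fox_mu : 'M[F]_2 :=
  1 - U * (M * U^-1) - U * (M * (U^-1 * (M^-1 * U^-1)))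
    + U * (M * (U^-1 * (M^-1 * (U^-1 * M)))).

(** The Fox derivative of w by m. *)
Definition w_fox_m : 'M[F]_2 :=
  U - U * (M * (U^-1 * M^-1)) + U * (M * (U^-1 * (M^-1 * U^-1))).

Lemma lin4_MV : M^-1 = lin4 x (- 1) 0 0.
Proof. by rewrite (sl2_inv detM) -/x; apply: mx2P; rewrite !mx2E /=; ring. Qed.

Lemma lin4_UV : U^-1 = lin4 y 0 (- 1) 0.
Proof. by rewrite (sl2_inv detU) -/y; apply: mx2P; rewrite !mx2E /=; ring. Qed.

(** The next four words are the prefixes of w of lengths 3 to 6.  With 1 and mu
    they are the words occurring in its Fox derivatives. *)
Lemma w_prefix3E : U * (M * U^-1) = lin4
    (y * z - x * y ^+ 2 + x)
    (y ^+ 2 - 1)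
    (- z + x * y)
    (- y).
Proof. by rewrite lin4_UV lin4_mulM lin4_mulU; congr lin4; ring. Qed.

Lemma w_prefix4E : U * (M * (U^-1 * M^-1)) = lin4
    (z ^+ 2 - x * y * z + x ^+ 2 - 1)
    (y * z - x)
    (y)
    (- z).
Proof.
by rewrite lin4_MV lin4_mulUV lin4_mulM lin4_mulU; congr lin4; ring.
Qed.

Lemma w_prefix5E : U * (M * (U^-1 * (M^-1 * U^-1))) = lin4
    (y * z ^+ 2 - x * y ^+ 2 * z + x ^+ 2 * y)
    (y ^+ 2 * z - z - x * y)
    (- z ^+ 2 + x * y * z - x ^+ 2 + 1)
    (- y * z + x).
Proof.
by rewrite {2}lin4_UV lin4_mulMV lin4_mulUV lin4_mulM lin4_mulU; congr lin4;
  ring.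
Qed.

Lemma w_prefix6E : U * (M * (U^-1 * (M^-1 * (U^-1 * M)))) = lin4
    (- z ^+ 3 + 2 * x * y * z ^+ 2 - x ^+ 2 * y ^+ 2 * z - x ^+ 2 * z + 2 * z
      + x ^+ 3 * y - x * y)
    (- y * z ^+ 2 + x * y ^+ 2 * z - x ^+ 2 * y + y)
    (- x * z ^+ 2 + x ^+ 2 * y * z - y * z - x ^+ 3 + 2 * x)
    (z ^+ 2 - x * y * z + x ^+ 2 - 1).
Proof.
by rewrite {3}lin4_M lin4_mulUV lin4_mulMV lin4_mulUV lin4_mulM lin4_mulU;
  congr lin4; ring.
Qed.

Lemma w_fox_muE : w_fox_mu = lin4
    (- z ^+ 3 + 2 * x * y * z ^+ 2 - y * z ^+ 2 - x ^+ 2 * y ^+ 2 * z + x * y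
      ^+ 2 * z - x ^+ 2 * z - y * z + 2 * z + x ^+ 3 * y + x * y ^+ 2 - x ^+ 2
      * y - x * y - x + 1)
    (- y * z ^+ 2 + x * y ^+ 2 * z - y ^+ 2 * z + z - x ^+ 2 * y - y ^+ 2 + x
      * y + y + 1)
    (- x * z ^+ 2 + z ^+ 2 + x ^+ 2 * y * z - x * y * z - y * z + z - x ^+ 3 -
      x * y + x ^+ 2 + 2 * x - 1)
    (z ^+ 2 - x * y * z + y * z + x ^+ 2 + y - x - 1).
Proof.
rewrite /w_fox_mu w_prefix3E w_prefix5E w_prefix6E lin4_1 !lin4N !lin4D.
by congr lin4; ring.
Qed.

Lemma w_fox_mE : w_fox_m = lin4
    (y * z ^+ 2 - z ^+ 2 - x * y ^+ 2 * z + x * y * z + x ^+ 2 * y - x ^+ 2 + 1)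
    (y ^+ 2 * z - y * z - z - x * y + x)
    (- z ^+ 2 + x * y * z - x ^+ 2 - y + 2)
    (- y * z + z + x).
Proof.
rewrite /w_fox_m w_prefix4E w_prefix5E {1}lin4_U !lin4N !lin4D.
by congr lin4; ring.
Qed.

(** As polynomials in x, y, z, the determinant is [torsion_poly] + [riley]. *)
Lemma det_w_fox_mu : riley x y z = 0 -> \det w_fox_mu = torsion_poly x y z.
Proof.
move=> f0; rewrite w_fox_muE det_lin4 -[RHS]addr0 -f0 /riley /torsion_poly;
  ring.
Qed.

(** The Fox derivative of the relator m w m^-1 w^-1 by m, as it simplifies when
    m and w commute. *)
Definition relator_fox_m : 'M[F]_2 := 1 - w_mx + (M - 1) * w_fox_m.

Lemma relator_fox_mE : riley x y z = 0 -> relator_fox_m = lin4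
    (- y * z ^+ 2 - x * z ^+ 2 + z ^+ 2 + x * y ^+ 2 * z + x ^+ 2 * y * z - y
      ^+ 2 * z - x * y * z + z - x ^+ 2 * y - x ^+ 3 + x * y + x ^+ 2 + x)
    (y * z ^+ 2 - y ^+ 2 * z - x * y * z + y * z - x * z + z + x * y + x ^+ 2
      - x)
    (z ^+ 2 - x * y * z + y * z - z + x ^+ 2 + y - x - 2)
    (- z ^+ 2 + y * z + x * z - z - y - x + 2).
Proof.
move=> f0; rewrite /relator_fox_m w_mxE f0 w_fox_mE mulrBl mul1r lin4_mulM
  lin4_1 !lin4N !lin4D.
by congr lin4; ring.
Qed.

(** This determinant and that of [det_relator_fox_sum] are the numerators of the
    torsion that go with the denominators det (mu - 1) and det (m mu - 1); the
    determinant of [w_fox_mu] serves for det (m - 1). *)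
Lemma det_relator_fox_m : riley x y z = 0 ->
  \det relator_fox_m = torsion_poly x y z * (2 - y).
Proof.
move=> f0; rewrite relator_fox_mE // det_lin4.
(* The cofactor of riley is the quotient of a division by riley, whose
   leading coefficient in z is -1. *)
transitivity (torsion_poly x y z * (2 - y) + (- x * z ^+ 2 + z ^+ 2 + x ^+ 2
  * y * z - x * y * z - y * z - x ^+ 3 - x * y + x ^+ 2 + y + 4 * x - 2) *
  riley x y z).
  by rewrite /riley /torsion_poly; ring.
by rewrite f0 mulr0 addr0.
Qed.

Lemma lin4_mulrM a b c d :
  lin4 a b c d * M = lin4 (c * (z - x * y) - b - d * y)
   (a + b * x + c * y + d * z) (c * x + d) (- c).
Proof.
have UM : U * M = lin4 (z - x * y) y x (- 1).
  by rewrite {1}lin4_M lin4_mulU; congr lin4; ring.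
have -> : lin4 a b c d * M =
    a *: M + b *: (M * M) + c *: (U * M) + d *: (M * (U * M)).
  by apply: mx2P; rewrite !mx2E /=; ring.
rewrite UM lin4_mulM {1 3}lin4_M lin4_mulM !lin4Z !lin4D.
by congr lin4; ring.
Qed.

Lemma det_relator_fox_sum : riley x y z = 0 ->
  \det ((M - 1) * w_fox_mu - relator_fox_m * M) = torsion_poly x y z * (2 - z).
Proof.
move=> f0; have -> : (M - 1) * w_fox_mu - relator_fox_m * M = lin4
    (y * z ^+ 2 + z ^+ 2 - x * y ^+ 2 * z + y ^+ 2 * z - x * y * z + x ^+ 2
      * y - 2 * x * y + x ^+ 2 + y - 2)
    (- y * z ^+ 2 + y ^+ 2 * z + y * z + x * z - 2 * z - x * y + y - x)
    (- z ^+ 2 + x * y * z - y * z - x ^+ 2 + 2 * x)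
    (z ^+ 2 - y * z + x - 2).
  rewrite relator_fox_mE // lin4_mulrM w_fox_muE mulrBl mul1r lin4_mulM !lin4N
    !lin4D.
  by congr lin4; ring.
rewrite det_lin4.
transitivity (torsion_poly x y z * (2 - z) + (- z ^+ 2 + x * y * z - y * z - z
  - x ^+ 2 + 2 * x + 2) * riley x y z).
  by rewrite /riley /torsion_poly; ring.
by rewrite f0 mulr0 addr0.
Qed.

End Lin4.

(** * Words and reducibility *)

Section Words.
Variables (F : fieldType) (n : nat) (rho : 'I_n -> 'M[F]_2).

Lemma word_mx_cat v w : word_mx rho (v ++ w) = word_mx rho v * word_mx rho w.
Proof.
elim: v => [|[i e] v IH] /=; first by rewrite mul1r.
by rewrite IH -!mulmxE mulmxA.
Qed.

Hypothesis det_rho : forall i, \det (rho i) = 1.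

Lemma det_word_mx w : \det (word_mx rho w) = 1.
Proof.
elim: w => [|[i e] w IH] /=; first exact: det1.
by rewrite det_mulmx IH mulr1; case: e; rewrite ?det_inv det_rho ?invr1.
Qed.

Lemma word_mx_unit w : word_mx rho w \is a GRing.unit.
Proof. exact/sl2_unit/det_word_mx. Qed.

Lemma word_mx_winv w : word_mx rho (winv w) = (word_mx rho w)^-1.
Proof.
elim: w => [|[i e] w IH]; first by rewrite /= invr1.
have u : rho i \is a GRing.unit by apply: sl2_unit.
rewrite /winv map_cons rev_cons -cats1 word_mx_cat -/(winv w) IH /= mulmx1
  mulmxE.
by case: e; rewrite /= -?[invmx _]/((_)^-1) invrM ?invrK ?unitrV ?word_mx_unit.
Qed.

Lemma word_mx_wpow w k : word_mx rho (wpow w k) = word_mx rho w ^ k.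
Proof.
have P v j : word_mx rho (flatten (nseq j v)) = word_mx rho v ^+ j.
  by elim: j => [|j IH] //=; rewrite word_mx_cat IH exprS.
by case: k => k; rewrite /wpow P // word_mx_winv exprVn.
Qed.

End Words.

Section CommonEigenvector.
Variable F : closedFieldType.
Implicit Types (M U K : 'M[F]_2) (v w : 'cV[F]_2).

Lemma cV2P v w : v 0 0 = w 0 0 -> v 1 0 = w 1 0 -> v = w.
Proof.
move=> e0 e1; apply/matrixP => i j; rewrite !ord1.
by case: i => [[|[|//]] ?]; [move: e0 | move: e1]; congr (_ = _);
  congr (_ _ _); apply: val_inj.
Qed.

Lemma mul2vE K v i : (K *m v) i 0 = K i 0 * v 0 0 + K i 1 * v 1 0.
Proof.
rewrite mxE !big_ord_recl big_ord0 addr0.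
by congr (_ * _ + K i _ * v _ 0); apply: val_inj.
Qed.

Lemma singular_mx2_kernel K :
  \det K = 0 -> exists2 v : 'cV[F]_2, v != 0 & K *m v = 0.
Proof.
move=> dK; have : \det (K^T) = 0 by rewrite det_tr.
move/eqP/det0P => [v v0 vK].
exists v^T; first by apply: contra_neq v0 => vT; rewrite -[v]trmxK vT trmx0.
by apply: trmx_inj; rewrite trmx_mul trmxK vK trmx0.
Qed.

Lemma mx2_kernel_line K v w :
  K != 0 -> v != 0 -> K *m v = 0 -> K *m w = 0 -> exists c, w = c *: v.
Proof.
move=> K0 v0 Kv Kw.
have d0 : v 0 0 * w 1 0 = v 1 0 * w 0 0.
  apply/eqP; rewrite -subr_eq0; apply: contraNT K0 => d0.
  pose P : 'M[F]_2 := \matrix_(i, j) (if j == 0 then v i 0 else w i 0).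
  have uP : P \is a GRing.unit.
    by rewrite unitmxE unitfE det2E !mxE /= [w 0 0 * _]mulrC.
  apply/eqP/(mulIr uP); rewrite mul0r; apply: mx2P;
    rewrite mul2E !mxE /= -mul2vE ?Kv ?Kw mxE //.
have [v00|v00] := eqVneq (v 0 0) 0.
  have v10 : v 1 0 != 0.
    by apply: contraNneq v0 => v10; apply/eqP/cV2P; rewrite mxE.
  exists (w 1 0 / v 1 0); apply: cV2P; rewrite mxE; last by rewrite divfK.
  rewrite v00 mulr0; apply: (mulfI v10); rewrite -d0 v00 mul0r mulr0 //.
exists (w 0 0 / v 0 0); apply: cV2P; rewrite mxE; first by rewrite divfK.
by rewrite mulrAC [w 0 0 * _]mulrC -d0 mulrC mulKf.
Qed.

Lemma mx2_eigenvalue M : exists c, \det (M - c%:M) = 0.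
Proof.
have [c] := solve_monicpoly (fun i => if i == 0%N then - \det M else \tr M)
  (isT : 0 < 2)%N.
rewrite !big_ord_recl big_ord0 /= mulr1 addr0 expr1 => cE; exists c.
have -> : \det (M - c%:M) = c ^+ 2 - (- \det M + \tr M * c).
  by rewrite !mx2E /=; ring.
by rewrite cE subrr.
Qed.

Lemma stable_kernel_eigenvector M U K v :
  K != 0 -> v != 0 -> K *m v = 0 -> K *m (M *m v) = 0 -> K *m (U *m v) = 0 ->
  exists w, [/\ w != 0, exists c, M *m w = c *: w & exists d, U *m w = d *: w].
Proof.
by move=> K0 v0 Kv KM KU; exists v; split=> //; apply: (@mx2_kernel_line K).
Qed.

(** Let K be the commutator, assumed singular.  Both K and K M have trace zero,
    so the polarized Cayley-Hamilton identity reads K M = (Tr M - M) K, and the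
    kernel of K is stable under M; the same holds for U.  If K = 0, an
    eigenspace of M serves instead of the kernel of K, unless M is scalar. *)
Lemma common_eigenvector M U : \det (M * U - U * M) = 0 ->
  exists w, [/\ w != 0, exists c, M *m w = c *: w & exists d, U *m w = d *: w].
Proof.
set K := M * U - U * M => dK.
have [K0|K0] := eqVneq K 0; last first.
  have [v v0 Kv] := singular_mx2_kernel dK.
  apply: (stable_kernel_eigenvector K0 v0 Kv).
    have E : K * M = (\tr M)%:M * K - M * K.
      by apply: mx2P; rewrite !mx2E /=; ring.
    by rewrite mulmxA [K *m M]E mulmxBl -!mulmxA Kv !mulmx0 subrr.
  have E : K * U = (\tr U)%:M * K - U * K.
    by apply: mx2P; rewrite !mx2E /=; ring.
  by rewrite mulmxA [K *m U]E mulmxBl -!mulmxA Kv !mulmx0 subrr.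
have MU : M * U = U * M by apply/eqP; rewrite -subr_eq0; apply/eqP.
have [c dc] := mx2_eigenvalue M.
have [N0|N0] := eqVneq (M - c%:M) 0.
  have [d dd] := mx2_eigenvalue U; have [v v0 Uv] := singular_mx2_kernel dd.
  exists v; split=> //; first by exists c; move/subr0_eq: N0 => ->;
    rewrite mul_scalar_mx.
  by exists d; move/eqP: Uv; rewrite mulmxBl mul_scalar_mx subr_eq0 => /eqP.
have [v v0 Nv] := singular_mx2_kernel dc.
apply: (stable_kernel_eigenvector N0 v0 Nv).
  by rewrite mulmxA mulmxBl -scalar_mxC -mulmxBr -mulmxA Nv mulmx0.
by rewrite mulmxA mulmxBl -scalar_mxC [M *m U]MU -mulmxBr -mulmxA Nv mulmx0.
Qed.

End CommonEigenvector.

Section Irreducible.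
Variable F : closedFieldType.
Variable rho : 'I_2 -> 'M[F]_2.
Hypothesis det_rho : forall i, \det (rho i) = 1.
Let M := rho ord0.
Let U := rho ord_max.

(** The commutator of the two generators has determinant -g, and it is singular
    exactly when they have a common eigenvector. *)
Lemma irreducible_repP :
  irreducible_rep rho <-> reducible_locus (\tr M) (\tr U) (\tr (M * U)) != 0.
Proof.
have dM : \det M = 1 := det_rho _.
have dU : \det U = 1 := det_rho _.
split=> [irr|].
  apply/eqP => g0; apply: irr.
  have [] := @common_eigenvector _ M U.
    by rewrite det_commutator // g0 oppr0.
  move=> v [v0 [c Mv] [d Uv]]; exists v; split=> // w.
  have inv A e : \det A = 1 -> A *m v = e *: v -> invmx A *m v = e^-1 *: v.
    move=> dA Av; have uA : A \in unitmx by rewrite unitmxE dA unitr1.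
    have e0 : e != 0.
      apply: contraNneq v0 => e0; rewrite -(mulKmx uA v) Av e0 scale0r mulmx0
        //.
    apply: (can_inj (mulKmx uA)); rewrite mulKVmx //
      -scalemxAr Av scalerA mulVf //.
    by rewrite scale1r.
  elim: w => [|[i e] w [k IH]] /=; first by exists 1; rewrite mul1mx scale1r.
  rewrite -mulmxA IH -scalemxAr.
  have [f ->] : exists f, (if e then invmx (rho i) else rho i) *m v = f *: v.
    have [->|->] : i = ord0 \/ i = ord_max.
    - by case: i => [[|[|//]] ?]; [left | right]; apply: val_inj.
    - by case: e; [exists c^-1; apply: inv | exists c].
    - by case: e; [exists d^-1; apply: inv | exists d].
  by exists (k * f); rewrite scalerA.
move=> g0 [v [v0 ev]]; move/negP: v0; apply.
have [c] := ev (gen ord0); have [d] := ev (gen ord_max).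
rewrite /= !mulmx1 => Uv Mv.
have uK : M * U - U * M \in unitmx.
  by rewrite unitmxE det_commutator // unitrN unitfE.
rewrite -(mulKmx uK v) mulmxBl -!mulmxA Uv Mv -!scalemxAr Uv Mv !scalerA.
by rewrite [d * c]mulrC subrr mulmx0.
Qed.

End Irreducible.

(** * Irreducible characters of the Whitehead link *)

Definition pt3 (F : fieldType) (x y z : F) : 'rV[F]_3 :=
  \row_(i < 3) [:: x; y; z]`_i.

Lemma char_ptE (F : fieldType) (rho : 'I_2 -> 'M[F]_2) :
  char_pt rho = pt3 (\tr (rho ord0)) (\tr (rho ord_max))
                    (\tr (rho ord0 * rho ord_max)).
Proof. by rewrite /char_pt /character /= !mulmx1. Qed.

Lemma pt3_inj (F : fieldType) (x y z x' y' z' : F) :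
  pt3 x y z = pt3 x' y' z' -> [/\ x = x', y = y' & z = z'].
Proof.
move=> /matrixP e.
by split; [move: (e 0 0) | move: (e 0 1) | move: (e 0 ord_max)]; rewrite !mxE.
Qed.

Lemma pt3_eta (F : fieldType) (v : 'rV[F]_3) :
  v = pt3 (v 0 0) (v 0 1) (v 0 ord_max).
Proof.
apply/rowP => i; rewrite mxE.
by case: i => [[|[|[|//]]] ?] /=; congr (v _ _); apply: val_inj.
Qed.

Section WhiteheadRepresentations.
Variable F : fieldType.
Implicit Types rho : 'I_2 -> 'M[F]_2.

Lemma word_mx_w rho : word_mx rho wl_w = w_mx (rho ord0) (rho ord_max).
Proof. by rewrite /= mulmx1. Qed.

Lemma is_rep_whitehead rho :
  is_rep whitehead rho <->
  (forall i, \det (rho i) = 1) /\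
  rho ord0 * w_mx (rho ord0) (rho ord_max) =
    w_mx (rho ord0) (rho ord_max) * rho ord0.
Proof.
set M := rho ord0; set W := w_mx _ _.
have rel : (forall i, \det (rho i) = 1) ->
   word_mx rho (wl_m ++ wl_w ++ winv wl_m ++ winv wl_w) = M * W * (W * M)^-1.
  move=> d; rewrite (word_mx_cat _ wl_m) (word_mx_cat _ wl_w).
  rewrite (word_mx_cat _ (winv wl_m)).
  rewrite !(word_mx_winv d) word_mx_w /= mulmx1 -/M -/W.
  have uW : W \is a GRing.unit by rewrite /W -word_mx_w word_mx_unit.
  by rewrite [(W * M)^-1](invrM uW (sl2_unit (d _))) !mulrA.
split=> -[d H]; split=> //.
  have := H _ (mem_head _ _); rewrite rel // => e.
  have uWM : W * M \is a GRing.unit.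
    by rewrite /W -word_mx_w unitrMl ?(sl2_unit (d _)) // word_mx_unit.
  by rewrite -[LHS](divrK uWM) e mul1r.
move=> w; rewrite inE => /eqP->; rewrite rel // H divrr //.
by rewrite /W -word_mx_w unitrMl ?(sl2_unit (d _)) // word_mx_unit.
Qed.

Lemma commutator_w_mx (M U : 'M[F]_2) : \det M = 1 -> \det U = 1 ->
  M * w_mx M U - w_mx M U * M =
    riley (\tr M) (\tr U) (\tr (M * U)) *: (M * U - U * M).
Proof.
move=> dM dU; rewrite w_mxE //; move: (riley _ _ _) => f.
by rewrite /lin4 scale0r addr0; apply: mx2P; rewrite !mx2E /=; ring.
Qed.

End WhiteheadRepresentations.

Section WhiteheadCharacters.
Variable F : closedFieldType.
Implicit Types rho : 'I_2 -> 'M[F]_2.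

(** The commutator [M, w] is [riley] times [M, U], which is nonzero for an
    irreducible representation. *)
Lemma whitehead_irrepP rho : (forall i, \det (rho i) = 1) ->
  irreducible_rep rho ->
  is_rep whitehead rho <->
    riley (\tr (rho ord0)) (\tr (rho ord_max)) (\tr (rho ord0 * rho ord_max))
      = 0.
Proof.
move=> d /(irreducible_repP d) g0.
have K0 : rho ord0 * rho ord_max - rho ord_max * rho ord0 != 0.
  apply: contraNneq g0 => K0; have := det_commutator (d ord0) (d ord_max).
  by rewrite K0 det0 => /esym/eqP; rewrite oppr_eq0.
have E := commutator_w_mx (d ord0) (d ord_max).
rewrite is_rep_whitehead; split=> [[_ comm]|f0]; last first.
  by split=> //; apply/eqP; rewrite -subr_eq0 E f0 scale0r.
by move/eqP: E; rewrite comm subrr eq_sym scaler_eq0 (negPf K0) orbF => /eqP.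
Qed.

(** The matrices are chosen so that m mu is triangular with diagonal entries
    1/e and e, where e + 1/e = z. *)
Lemma sl2_pair_exists (x y z : F) : exists rho,
  (forall i, \det (rho i) = 1) /\ char_pt rho = pt3 x y z.
Proof.
have [e] := solve_monicpoly (fun i => if i == 0%N then -1 else z)
  (isT : 0 < 2)%N.
rewrite !big_ord_recl big_ord0 /= mulr1 addr0 expr1 => eE.
have e0 : e != 0.
  apply/eqP => e0; move/eqP: eE; rewrite e0 expr0n mulr0 addr0 eq_sym oppr_eq0
    oner_eq0 //.
have eV : e^-1 = z - e.
  by apply: (mulfI e0); rewrite divff // mulrBr -expr2 eE [e * z]mulrC; ring.
pose M : 'M[F]_2 := \matrix_(i, j) (if i == 0 then if j == 0 then x else -1
                                    else if j == 0 then 1 else 0).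
pose U : 'M[F]_2 := \matrix_(i, j) (if i == 0 then if j == 0 then 0 else e
                                    else if j == 0 then - e^-1 else y).
exists (fun i => if i == ord0 then M else U); split.
  move=> i; case: ifP => _; rewrite det2E !mxE /=; first by ring.
  by rewrite mul0r sub0r mulrN opprK divff.
by rewrite char_ptE /= !tr2E !mul2E !mxE /= eV; congr pt3; ring.
Qed.

Lemma Xirr_whiteheadP x y z :
  Xirr F whitehead (pt3 x y z) <->
  riley x y z = 0 /\ reducible_locus x y z != 0.
Proof.
split=> [[rho [rep irr]]|[f0 g0]].
  rewrite char_ptE => /pt3_inj[-> -> ->]; have [d _] := rep.
  by split; [apply/(whitehead_irrepP d irr) | apply/(irreducible_repP d)].
have [rho [d ch]] := sl2_pair_exists x y z; exists rho.
have [ex ey ez] := pt3_inj (etrans (esym (char_ptE rho)) ch).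
have irr : irreducible_rep rho by apply/(irreducible_repP d); rewrite ex ey ez.
by split=> //; apply/(whitehead_irrepP d irr); rewrite ex ey ez.
Qed.

End WhiteheadCharacters.

(** * Irreducible characters of the surgery *)

Section Surgery.

(** The first relation reduces to b = a^3 b^-2 a^3 and the second one to
    a^3 = b^3; substituting gives b = b^4. *)
Lemma surgery_relators (A : unitRingType) (a b : A) :
  a \is a GRing.unit -> b \is a GRing.unit ->
  (a ^- 2 * b) ^+ 3 = a ^- 2 * b * a * b ^- 2 * a * b /\
  (b^-1 * a) ^+ 3 = b^-1 * a * b^-1 * a * b * a ^- 3 * b * a <->
  a ^+ 3 = 1 /\ b ^+ 3 = 1.
Proof.
move=> ua ub.
have [c Ec] : exists c, c = a ^+ 2 by exists (a ^+ 2).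
have [d Ed] : exists d, d = b ^+ 2 by exists (b ^+ 2).
have uc : c \is a GRing.unit by rewrite Ec unitrX.
have ud : d \is a GRing.unit by rewrite Ed unitrX.
have Ea3 : a ^+ 3 = c * a by rewrite exprSr Ec.
have Ea3' : a ^+ 3 = a * c by rewrite exprS Ec.
have Eb3 : b ^+ 3 = d * b by rewrite exprSr Ed.
have Eb3' : b ^+ 3 = b * d by rewrite exprS Ed.
rewrite -Ec -Ed; split=> [[e1 e2]|[a3 b3]].
  have {}e1 : c^-1 * b * c^-1 = a * d^-1 * a.
    have ucb : c^-1 * b \is a GRing.unit by rewrite unitrMl // unitrV.
    apply/(mulIr ub)/(mulrI ucb); rewrite !mulrA -e1.
    by rewrite !exprS expr0 mulr1 !mulrA.
  have {}e1 : b = a ^+ 3 * d^-1 * a ^+ 3.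
    rewrite [LHS](_ : b = c * (c^-1 * b * c^-1) * c); last first.
      by rewrite !mulrA divrr // mul1r divrK.
    by rewrite e1 {1}Ea3 Ea3' !mulrA.
  have {}e2 : b^-1 = b * a ^- 3 * b.
    have uba : b^-1 * a \is a GRing.unit by rewrite unitrMl // unitrV.
    apply/(mulIr ua)/(mulrI uba)/(mulrI uba); rewrite !mulrA -e2.
    by rewrite !exprS expr0 mulr1 !mulrA.
  have e4 : a ^+ 3 = b ^+ 3.
    apply: invr_inj; apply/(mulrI ub)/(mulIr ub); rewrite -e2 Eb3.
    by rewrite invrM // mulrA divrr // mul1r Ed invrM // divrK.
  have b3 : b ^+ 3 = 1.
    apply: (mulrI ub); rewrite mulr1 [RHS]e1 e4.
    by rewrite [in RHS]Eb3' mulrK // -Eb3'.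
  by rewrite e4.
have a2 : c^-1 = a by apply: (mulrI uc); rewrite divrr // -Ea3.
have b2 : d^-1 = b by apply: (mulrI ud); rewrite divrr // -Eb3.
have b1 : b^-1 = d by rewrite -b2 invrK.
rewrite a2 b2 a3 invr1 mulr1; split; first by rewrite !exprS expr0 mulr1 !mulrA.
rewrite !exprS expr0 mulr1 !mulrA; congr (_ * _).
by rewrite -[RHS]mulrA -expr2 -Ed b1.
Qed.

End Surgery.

Lemma sl2_cube (F : fieldType) (A : 'M[F]_2) : \det A = 1 ->
  A ^+ 3 = (\tr A ^+ 2 - 1) *: A - (\tr A)%:M.
Proof.
move=> dA; have -> : A ^+ 3 = A * (A * A) by [].
rewrite sqr_mx2 dA mulrBr -scalerAr sqr_mx2 dA -mulmxE mul_mx_scalar.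
by apply: mx2P; rewrite !mxE /=; ring.
Qed.

(** With t = Tr A, the Cayley-Hamilton theorem gives A^3 = (t^2 - 1) A - t.  As
    A is not scalar, A^3 = 1 forces t^2 = 1 and then t = -1. *)
Lemma sl2_cube_eq1 (F : fieldType) (A B : 'M[F]_2) : \det A = 1 ->
  A * B != B * A -> A ^+ 3 = 1 <-> \tr A = -1.
Proof.
move=> dA nAB; rewrite sl2_cube //; split=> [e|->]; last first.
  by apply: mx2P; rewrite !mxE /=; ring.
have {}e : (\tr A ^+ 2 - 1) *: A = (1 + \tr A)%:M.
  by rewrite raddfD /= -[1%:M]e subrK.
have t1 : \tr A ^+ 2 - 1 = 0.
  apply/eqP; apply: contraNT nAB => t1.
  have -> : A = ((1 + \tr A) / (\tr A ^+ 2 - 1))%:M.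
    by rewrite mulrC -scale_scalar_mx -e scalerA mulVf // scale1r.
  by rewrite -mulmxE scalar_mxC.
move: e; rewrite t1 scale0r => /matrixP/(_ 0 0); rewrite !mxE /= mulr1n => e.
by apply/eqP; rewrite -addr_eq0 addrC -e.
Qed.

Lemma is_rep_cat (F : fieldType) n (P Q : presentation n)
    (rho : 'I_n -> 'M[F]_2) :
  is_rep (P ++ Q) rho <->
  is_rep P rho /\ (forall w, w \in Q -> word_mx rho w = 1%:M).
Proof.
split=> [[d H]|[[d HP] HQ]].
  by split; [split=> // |] => w wPQ; apply: H; rewrite mem_cat wPQ ?orbT.
by split=> // w; rewrite mem_cat => /orP[]; [apply: HP | apply: HQ].
Qed.

Lemma filling_relator (F : fieldType) n (rho : 'I_n -> 'M[F]_2) (m l : word n) :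
  (forall i, \det (rho i) = 1) ->
  word_mx rho (wpow m (-3) ++ wpow l 1) = 1%:M <->
    word_mx rho m ^+ 3 = word_mx rho l.
Proof.
move=> d; rewrite word_mx_cat !(word_mx_wpow d) expr1z.
have u := unitrX 3 (word_mx_unit d m).
split=> [e|<-]; last by rewrite mulVr.
by rewrite -[LHS]mulr1 -[1]e mulrA divrr // mul1r.
Qed.

Section SurgeryCharacters.
Variable F : closedFieldType.
Implicit Types rho : 'I_2 -> 'M[F]_2.

Lemma is_rep_surgery rho : is_rep (whitehead_surgery (-3) 1 (-3) 1) rho <->
  is_rep whitehead rho /\
  (rho ord0 * rho ord_max) ^+ 3 = 1 /\ (rho ord0 ^+ 2 * rho ord_max) ^+ 3 = 1.
Proof.
set M := rho ord0; set U := rho ord_max.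
have Ea : word_mx rho wl_a = M * U by rewrite word_mx_cat /= !mulmx1.
have Eb : word_mx rho wl_b = M ^+ 2 * U by rewrite word_mx_cat /= !mulmx1.
suff E : (forall i, \det (rho i) = 1) ->
    (forall w, w \in [:: wpow meridian1 (-3) ++ wpow longitude1 1;
                         wpow meridian2 (-3) ++ wpow longitude2 1] ->
       word_mx rho w = 1%:M) <->
    (M * U) ^+ 3 = 1 /\ (M ^+ 2 * U) ^+ 3 = 1.
  by rewrite is_rep_cat; split=> -[rep H]; split=> //; apply/(E rep.1).
move=> d; rewrite -surgery_relators; first last.
- by rewrite -Eb word_mx_unit.
- by rewrite -Ea word_mx_unit.
have m1 : word_mx rho meridian1 = (M * U) ^- 2 * (M ^+ 2 * U).
  by rewrite word_mx_cat (word_mx_wpow d) Ea Eb.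
have l1 : word_mx rho longitude1 =
  (M * U) ^- 2 * (M ^+ 2 * U) * (M * U) * (M ^+ 2 * U) ^- 2
    * (M * U) * (M ^+ 2 * U).
  rewrite /longitude1 (word_mx_cat _ (wpow _ _)) (word_mx_cat _ wl_b).
  rewrite (word_mx_cat _ wl_a) (word_mx_cat _ (wpow _ _)) (word_mx_cat _ wl_a).
  by rewrite !(word_mx_wpow d) Ea Eb !mulrA.
have m2 : word_mx rho meridian2 = (M ^+ 2 * U)^-1 * (M * U).
  by rewrite word_mx_cat (word_mx_winv d) Ea Eb.
have l2 : word_mx rho longitude2 =
  (M ^+ 2 * U)^-1 * (M * U) * (M ^+ 2 * U)^-1 * (M * U) * (M ^+ 2 * U)
    * (M * U) ^- 3 * (M ^+ 2 * U) * (M * U).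
  rewrite /longitude2 (word_mx_cat _ (winv _)) (word_mx_cat _ wl_a).
  rewrite (word_mx_cat _ (winv _)) (word_mx_cat _ wl_a) (word_mx_cat _ wl_b).
  rewrite (word_mx_cat _ (wpow _ _)) (word_mx_cat _ wl_b).
  by rewrite (word_mx_winv d) (word_mx_wpow d) Ea Eb !mulrA.
rewrite -l1 -l2 -m1 -m2 -!(filling_relator _ _ d).
split=> [H|[H1 H2] w]; first by split; apply: H; rewrite !inE eqxx ?orbT.
by rewrite !inE => /orP[]/eqP->.
Qed.

(** The traces of a = m mu and b = m^2 mu are z and x z - y; both are -1 exactly
    when z = -1 and x + y = 1. *)
Lemma Xirr_surgeryP x y z :
  Xirr F (whitehead_surgery (-3) 1 (-3) 1) (pt3 x y z) <->
  [/\ z = -1, x + y = 1 & reducible_locus x y z != 0].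
Proof.
have key rho : (forall i, \det (rho i) = 1) -> irreducible_rep rho ->
    (rho ord0 * rho ord_max) ^+ 3 = 1 /\
    (rho ord0 ^+ 2 * rho ord_max) ^+ 3 = 1 <->
    \tr (rho ord0 * rho ord_max) = -1 /\ \tr (rho ord0) + \tr (rho ord_max) = 1.
  move=> d /(irreducible_repP d).
  set M := rho ord0; set U := rho ord_max => g0.
  have dM : \det M = 1 := d _; have dU : \det U = 1 := d _.
  have uM : M \is a GRing.unit by apply: sl2_unit.
  have dMU : \det (M * U) = 1 by rewrite -mulmxE det_mulmx dM dU mulr1.
  have dMMU : \det (M ^+ 2 * U) = 1.
    by rewrite expr2 -mulrA -mulmxE det_mulmx dM mul1r.
  have nMU : M * U != U * M.
    apply: contraNneq g0 => e; have := det_commutator dM dU.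
    by rewrite e subrr det0 => /esym/eqP; rewrite oppr_eq0.
  have nMUM : M * U * M != M * (M * U).
    by apply: contraNneq nMU; rewrite -mulrA => /(mulrI uM) ->.
  have nMMUM : M ^+ 2 * U * M != M * (M ^+ 2 * U).
    apply: contraNneq nMUM; rewrite expr2 -!mulrA => /(mulrI uM) -> //.
  rewrite (sl2_cube_eq1 dMU nMUM) (sl2_cube_eq1 dMMU nMMUM).
  have -> : \tr (M ^+ 2 * U) = \tr M * \tr (M * U) - \tr U.
    rewrite expr2 sqr_mx2 dM mulrBl -scalerAl -mulmxE mul_scalar_mx scale1r.
    by rewrite raddfB /= mxtraceZ.
  by split=> -[-> e]; split=> //; [move/eqP: e|]; rewrite ?mulrN1;
     [rewrite -opprD eqr_opp => /eqP | rewrite -opprD e].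
split=> [[rho [rep irr]]|[ez exy g0]].
  move/is_rep_surgery: (rep) => [[d _] /(key _ d irr)[tz txy]].
  rewrite char_ptE => /pt3_inj[-> -> ->]; split=> //.
  exact/(irreducible_repP d).
have : Xirr F whitehead (pt3 x y z).
  apply/Xirr_whiteheadP; split=> //.
  have ey : y = 1 - x by rewrite -exy; ring.
  by rewrite /riley ez ey; ring.
move=> [rho [rep irr ch]]; exists rho; split=> //.
apply/is_rep_surgery; split=> //; apply/(key _ rep.1 irr).
by have [<- <- <-] := pt3_inj (etrans ch (char_ptE rho)).
Qed.

End SurgeryCharacters.

(** * Torsion of complexes of length two *)

Section TorsionRatio.
Variable F : fieldType.

Lemma flat_submx (m n p : nat) (A : 'M[F]_(m, n)) (B : 'M[F]_(p, n)) :
  m = 0%N -> (A <= B)%MS.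
Proof. by move=> m0; move: A; rewrite m0 => A; rewrite flatmx0 sub0mx. Qed.

Lemma torsion_value_exists (d : nat -> nat)
    (bd : forall i, 'M[F]_(d i.+1, d i)) N :
  exists t, torsion_value bd N t.
Proof.
pose b' i := row_base (bd i) *m pinvmx (bd i).
eexists; exists (fun i => \rank (bd i)), (fun i => row_base (bd i)), b';
  split=> [i|i|].
- by rewrite row_base_free; split=> //; apply/eqmxP/eq_row_base.
- by rewrite /b' mulmxKpV // eq_row_base.
- by [].
Qed.

Lemma col_mx_flat (n k : nat) (A : 'M[F]_(0, k)) (B : 'M[F]_(n, k)) :
  col_mx A B = B.
Proof.
apply/matrixP => i j; rewrite mxE; case: splitP => [[]//|i' ei].
by congr (B _ _); apply: val_inj.
Qed.

Lemma transition_det_id (n : nat) (A : 'M[F]_n) : transition_det A = \det A.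
Proof. by rewrite /transition_det conform_mx_id. Qed.

(** Modulo the kernel of A, which lies in the row space of B, the family S is
    (S A) (b A)^-1 b.  Hence det (col_mx B b) / det (b A) does not depend on the
    chosen b. *)
Lemma exact_split (d0 d2 : nat) (A : 'M[F]_(d2 + d0, d0))
    (B : 'M[F]_(d2, d2 + d0)) (b S : 'M[F]_(d0, d2 + d0)) :
  (kermx A <= B)%MS -> b *m A \in unitmx ->
  \det (S *m A) * \det (col_mx B b) = \det (b *m A) * \det (col_mx B S).
Proof.
move=> kerAB ub; pose G := S *m A *m invmx (b *m A).
have : (S - G *m b <= B)%MS.
  apply: submx_trans kerAB; apply/sub_kermxP.
  by rewrite mulmxBl -!mulmxA mulVmx // mulmx1 subrr.
case/submxP => K eK.
have -> : col_mx B S = block_mx 1%:M 0 K G *m col_mx B b.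
  by rewrite mul_block_col mul1mx mul0mx addr0 -eK subrK.
rewrite det_mulmx det_lblock det1 mul1r mulrA; congr (_ * _).
have -> : S *m A = G *m (b *m A) by rewrite mulmxKV.
by rewrite det_mulmx mulrC.
Qed.

(** Exactness forces the ranks of the boundaries, and the chosen basis of the
    image of [bd 1] cancels against its lift.  What remains is a quotient that
    by [exact_split] can be computed with any family S of 1-chains; the equation
    is written without denominators. *)
Lemma torsion_value_ratio (d : nat -> nat) (bd : forall i, 'M[F]_(d i.+1, d i))
    (S : 'M[F]_(d 0, d 1)) t :
  (d 2 + d 0 = d 1)%N -> d 3 = 0%N -> acyclic bd -> torsion_value bd 2 t ->
  t * \det (S *m bd 0) = transition_det (col_mx (bd 1) S).
Proof.
move=> e1 e3 [full ex] [r [b [b' [bP b'P ->]]]].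
have rE i : r i = \rank (bd i).
  have [/eqP free_b /eqmxP eq_b] := bP i.
  by rewrite -eq_b free_b.
have r0 : r 0%N = d 0%N by rewrite rE; apply/eqP.
have r1 : r 1%N = d 2.
  rewrite rE -(eqmxP (ex 0%N)) mxrank_ker.
  by have /eqP-> := full; rewrite -e1 addnK.
have r2 : r 2 = 0%N.
  by apply/eqP; rewrite rE -leqn0 -[X in (_ <= X)%N]e3 rank_leq_row.
have kerAB : (kermx (bd 0%N) <= bd 1%N)%MS by rewrite (eqmxP (ex 0%N)).
have f0 := (bP 0%N).1; have f1 := (bP 1%N).1.
have g0 := b'P 0%N; have g1 := b'P 1%N.
rewrite !big_ord_recl big_ord0 mulr1 /=.
have -> : ((-1) ^+ (bump 0 0).+1 : int) = 1 by [].
have -> : ((-1) ^+ (bump 0 (bump 0 0)).+1 : int) = -1 by [].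
have -> : ((-1) ^+ 1 : int) = -1 by [].
rewrite /= expr1z -!invr_expz !expr1z.
move: (b 0%N) (b 1%N) (b 2) (b' 0%N) (b' 1%N) f0 f1 g0 g1.
move: (r 0%N) (r 1%N) (r 2) r0 r1 r2 => _ _ _ -> -> ->.
move: (bd 0%N) (bd 1%N) kerAB S.
clear -e1.
move: (d 0%N) (d 1%N) (d 2) e1 => d0 d1 d2 e1; subst d1.
move=> A B kerAB S b0 b1 b2 b'0 b'1 f0 f1 g0 g1.
have ub0 : b0 \in unitmx by rewrite -row_free_unit.
have ub'1 : b'1 \in unitmx.
  rewrite -row_free_unit; move: f1; rewrite -g1 /row_free => /eqP r1.
  by rewrite eqn_leq rank_leq_row -{1}r1 mxrankM_maxl.
have -> : transition_det (col_mx b2 b'1) = \det b'1.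
  by rewrite col_mx_flat transition_det_id.
rewrite !transition_det_id.
have -> : col_mx b1 b'0 = block_mx b'1 0 0 1%:M *m col_mx B b'0.
  by rewrite mul_block_col g1 mul1mx !mul0mx addr0 add0r.
rewrite det_mulmx det_lblock det1 mulr1.
have ub : b'0 *m A \in unitmx by rewrite g0.
have := exact_split S kerAB ub; rewrite g0 => E.
have d0u : \det b0 != 0 by rewrite -unitfE -unitmxE.
have d1u : \det b'1 != 0 by rewrite -unitfE -unitmxE.
apply: (mulfI d0u); rewrite -E; field; rewrite ?d0u ?d1u //.
Qed.

(** One family S with nonzero determinants witnesses that [bd 0] is onto and
    [bd 1] is injective, and exactness in the middle is a count of ranks. *)
Lemma acyclic_of_det (d : nat -> nat) (bd : forall i, 'M[F]_(d i.+1, d i))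
    (S : 'M[F]_(d 0, d 1)) :
  (d 2 + d 0 = d 1)%N -> (forall i, d i.+3 = 0%N) -> bd 1%N *m bd 0%N = 0 ->
  \det (S *m bd 0%N) != 0 -> transition_det (col_mx (bd 1%N) S) != 0 ->
  acyclic bd.
Proof.
move=> e1 e3 bd0 dS dBS.
have full : row_full (bd 0%N).
  rewrite /row_full eqn_leq rank_leq_col /=.
  have /mxrank_unit {1}<- : S *m bd 0%N \in unitmx by rewrite unitmxE unitfE.
  exact: mxrankM_maxr.
have free : row_free (bd 1%N).
  move: dBS; clear -e1; move: (bd 1%N) S => B; clear bd.
  move: (d 0%N) (d 1%N) (d 2) e1 B => d0 d1 d2 e1; subst d1 => B S.
  rewrite transition_det_id -unitfE -unitmxE -row_free_unit => fBS.
  apply/row_freeP; move/row_freeP: fBS => [X].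
  rewrite mul_col_mx scalar_mx_block => /(congr1 (usubmx)).
  rewrite col_mxKu block_mxEv col_mxKu => /(congr1 (lsubmx)).
  rewrite row_mxKl => E; exists (lsubmx X); rewrite -E.
  by rewrite -[X in _ = lsubmx (_ *m X)]hsubmxK mul_mx_row row_mxKl.
split=> // -[|[|i]].
- have sub : (bd 1%N <= kermx (bd 0%N))%MS by apply/sub_kermxP.
  rewrite sub andbT -(geq_leqif (mxrank_leqif_sup sub)) mxrank_ker.
  by have /eqP-> := full; have /eqP-> := free; rewrite -e1 addnK.
- rewrite (flat_submx _ _ (e3 0%N)) andbT.
  by move: free; rewrite -kermx_eq0 => /eqP->; rewrite sub0mx.
- by rewrite !flat_submx.
Qed.

End TorsionRatio.

Section TwoBlocks.
Variables (F : fieldType) (k : nat).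

(** The two results above for a complex with blocks of size k, k + k, k.  The
    dimensions of the complex are only propositionally equal to these numbers,
    hence the casts. *)
Lemma acyclic_block_complex (d : nat -> nat)
    (bd : forall i, 'M[F]_(d i.+1, d i))
    (e0 : k = d 0%N) (e1 : (k + k)%N = d 1%N) (e2 : k = d 2)
    (A1 A2 B1 B2 S1 S2 : 'M[F]_k) :
  bd 0%N = castmx (e1, e0) (col_mx A1 A2) ->
  bd 1%N = castmx (e2, e1) (row_mx B1 B2) ->
  (forall i, d i.+3 = 0%N) ->
  [/\ forall t, acyclic bd -> torsion_value bd 2 t ->
        t * \det (S1 *m A1 + S2 *m A2) = \det (block_mx B1 B2 S1 S2)
    & B1 *m A1 + B2 *m A2 = 0 -> \det (S1 *m A1 + S2 *m A2) != 0 ->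
      \det (block_mx B1 B2 S1 S2) != 0 -> acyclic bd].
Proof.
move=> bd0 bd1 e3; pose S := castmx (e0, e1) (row_mx S1 S2).
have dd : (d 2 + d 0 = d 1)%N by rewrite -e1 -e0 -e2.
have detS : \det (S *m bd 0%N) = \det (S1 *m A1 + S2 *m A2).
  rewrite bd0 /S; move: (d 0%N) (d 1%N) (e0) (e1) => d0 d1 e0' e1'; subst d0 d1.
  by rewrite !castmx_id mul_row_col.
have detBS : transition_det (col_mx (bd 1%N) S) = \det (block_mx B1 B2 S1 S2).
  rewrite bd1 /S; move: (d 0%N) (d 1%N) (d 2) (e0) (e1) (e2) =>
    d0 d1 d2 e0' e1' e2'.
  by subst d0 d1 d2; rewrite !castmx_id transition_det_id block_mxEv.
have cmp : bd 1%N *m bd 0%N = castmx (e2, e0) (B1 *m A1 + B2 *m A2).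
  rewrite bd0 bd1; move: (d 0%N) (d 1%N) (d 2) (e0) (e1) (e2) =>
    d0 d1 d2 e0' e1' e2'.
  by subst d0 d1 d2; rewrite !castmx_id mul_row_col.
split=> [t acy tv|BA0 nS nBS].
  by rewrite -detS -detBS (torsion_value_ratio S dd (e3 0%N) acy tv).
apply: (@acyclic_of_det _ _ _ S) => //; rewrite ?detS ?detBS //.
by rewrite cmp BA0; apply/matrixP => i j; rewrite castmxE !mxE.
Qed.

End TwoBlocks.

(** * Fox calculus with matrix values *)

Section FoxMatrices.
Variables (F : fieldType) (n : nat).
Implicit Types rho : 'I_n -> 'M[F]_2.

Definition zword_mx rho (z : zword n) : 'M[F]_2 :=
  \sum_(c <- z) word_mx rho c.2 *~ c.1.

Definition fox_mx rho (j : 'I_n) (w : word n) : 'M[F]_2 :=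
  zword_mx rho (fox j w).

(** Up to transposition, the dual action of a group ring element is its image
    under this representation; in SL_2 it has the same character as rho. *)
Definition contragredient rho : 'I_n -> 'M[F]_2 := fun i => ((rho i)^-1)^T.

Lemma fox_mx_nil rho j : fox_mx rho j [::] = 0.
Proof. by rewrite /fox_mx /zword_mx big_nil. Qed.

Lemma fox_mx_cons rho j x (w : word n) :
  fox_mx rho j (x :: w) =
    fox_mx rho j [:: x] + word_mx rho [:: x] * fox_mx rho j w.
Proof.
case: x => i e; rewrite /fox_mx /zword_mx /= !big_cat /= big_nil addr0.
congr (_ + _); rewrite big_map big_distrr /=.
by apply: eq_bigr => c _; rewrite mulmx1 -mulrzAr.
Qed.

Lemma fox_mx_cat rho j (v w : word n) :
  fox_mx rho j (v ++ w) = fox_mx rho j v + word_mx rho v * fox_mx rho j w.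
Proof.
elim: v => [|x v IH] /=; first by rewrite fox_mx_nil add0r mul1r.
rewrite fox_mx_cons IH [in RHS]fox_mx_cons -addrA mulrDr mulrA.
by rewrite -(word_mx_cat rho [:: x] v).
Qed.

Section Det1.
Variable rho : 'I_n -> 'M[F]_2.
Hypothesis d : forall i, \det (rho i) = 1.

Lemma fox_mx_letter j i e : fox_mx rho j [:: (i, e)] =
  if i == j then if e then - (rho i)^-1 else 1 else 0.
Proof.
rewrite /fox_mx /zword_mx /= cats0; case: eqP => _; last by rewrite big_nil.
by case: e; rewrite big_seq1 /= ?mulmx1 ?mulrN1z ?mulr1z.
Qed.

Lemma fox_mx_winv j w :
  fox_mx rho j (winv w) = - (word_mx rho w)^-1 * fox_mx rho j w.
Proof.
elim: w => [|[i e] w IH]; first by rewrite fox_mx_nil mulr0.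
rewrite /winv map_cons rev_cons -cats1 fox_mx_cat -/(winv w) IH (word_mx_winv
  d).
rewrite [in RHS]fox_mx_cons -[(i, e) :: w]/([:: (i, e)] ++ w) word_mx_cat.
have u v := word_mx_unit d v.
rewrite invrM // !mulNr mulrDr mulrA divrK // opprD addrC -[in RHS]mulrA;
  congr (_ + _).
rewrite -mulrN; congr (_ * _).
rewrite !fox_mx_letter; case: eqP => _; last by rewrite mulr0 oppr0.
by case: e; rewrite /= mulmx1 ?mulr1 // mulrN opprK mulVr ?unitrV ?(sl2_unit
  (d _)).
Qed.

(** The fundamental formula of the Fox calculus.  Applied to a relator it says
    that the boundary maps compose to zero. *)
Lemma fox_mx_fundamental w :
  \sum_j fox_mx rho j w * (rho j - 1) = word_mx rho w - 1.
Proof.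
elim: w => [|[i e] w IH].
  by rewrite big1 /= ?subrr // => j _; rewrite fox_mx_nil mul0r.
under eq_bigr => j _ do rewrite fox_mx_cons mulrDl -mulrA.
rewrite big_split -big_distrr /= IH (bigD1 i) //= big1 => [|j ji]; last first.
  by rewrite fox_mx_letter eq_sym (negPf ji) mul0r.
rewrite fox_mx_letter eqxx addr0 /= mulmx1 -[_ *m word_mx _ _]/(_ * word_mx
  rho w).
case: e; rewrite !mulrBr !mulr1.
  rewrite mulNr mulVr ?(sl2_unit (d _)) // opprK addrACA subrr addr0 addrC //.
by rewrite mul1r addrC addrA subrK.
Qed.

Lemma contragredient_det i : \det (contragredient rho i) = 1.
Proof. by rewrite det_tr det_inv d invr1. Qed.

Lemma word_mx_contragredient w :
  word_mx (contragredient rho) w = (word_mx rho (winv w))^T.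
Proof.
rewrite (word_mx_winv d); elim: w => [|[i e] w IH];
  first by rewrite invr1 /= trmx1.
rewrite -[(i, e) :: w]/([:: (i, e)] ++ w) !word_mx_cat invrM ?word_mx_unit //.
rewrite -mulmxE trmx_mul mulmxE IH; congr (_ * _); rewrite /= !mulmx1.
by case: e => //; apply/esym/(trmx_inv (invmx (rho i))).
Qed.

Lemma dual_action_tr z :
  (dual_action rho z)^T = zword_mx (contragredient rho) z.
Proof.
rewrite /dual_action raddf_sum; apply: eq_bigr => c _.
by rewrite raddfMz /= word_mx_contragredient.
Qed.

End Det1.
End FoxMatrices.

(** * The twisted complex of the Whitehead link *)

Definition whitehead_relator : word 2 :=
  wl_m ++ wl_w ++ winv wl_m ++ winv wl_w.

Section SmallBlocks.
Variables (T : Type) (k : nat).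

Lemma mxrow1E m (R : 'I_1 -> 'M[T]_(m, k)) e :
  \mxrow_c R c = castmx (erefl, e) (R 0).
Proof.
have -> : \mxrow_c R c = \mxrow_(c < 1) R 0.
  by apply: eq_mxrow => c; rewrite [c]ord1.
by rewrite [in RHS](mxEmxrow (R 0)) castmx_comp; symmetry; apply: castmx_id.
Qed.

Lemma row_mx_castr m n1 n2 n2' (e : n2 = n2') e'
    (A : 'M[T]_(m, n1)) (B : 'M[T]_(m, n2)) :
  row_mx A (castmx (erefl, e) B) = castmx (erefl, e') (row_mx A B).
Proof. by subst n2'; rewrite !castmx_id. Qed.

Lemma mxrow2E m (R : 'I_2 -> 'M[T]_(m, k)) e :
  \mxrow_c R c = castmx (erefl, e) (row_mx (R 0) (R 1)).
Proof.
have e1 : k = (\sum_(c < 1) k)%N by rewrite big_ord1.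
rewrite mxrow_recl (@mxrow1E _ _ e1) (row_mx_castr _ (congr1 (addn k) e1)).
rewrite castmx_comp; congr (castmx _ (row_mx _ (R _))); last exact: val_inj.
by congr (_, _); apply: eq_irrelevance.
Qed.

Lemma mxblock12E (R : 'I_1 -> 'I_2 -> 'M[T]_k) e e' :
  \mxblock_(a, c) R a c = castmx (e, e') (row_mx (R 0 0) (R 0 1)).
Proof.
have -> : \mxblock_(a, c) R a c = \mxblock_(a < 1, c < 2) R 0 c.
  by apply: eq_mxblock => a c; rewrite [a]ord1.
have /esym/(canRL (castmxK _ _)) -> := mxrowEblock (R 0).
by rewrite (mxrow2E _ e') castmx_comp; apply: eq_castmx.
Qed.

Lemma mxblock21E (R : 'I_2 -> 'I_1 -> 'M[T]_k) e e' :
  \mxblock_(a, c) R a c = castmx (e', e) (col_mx (R 0 0) (R 1 0)).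
Proof.
apply: trmx_inj; rewrite tr_mxblock trmx_cast tr_col_mx.
exact: (mxblock12E (fun a c => (R c a)^T)).
Qed.

End SmallBlocks.

Section BlockDet.
Variable F : fieldType.

(** Subtracting B1 times the lower rows from the upper ones leaves the zero
    block and B2 - B1 S.  The blocks have even size, so that exchanging them
    does not change the sign. *)
Lemma det_block_1l (B1 B2 S : 'M[F]_2) :
  \det (block_mx B1 B2 1%:M S) = \det (B2 - B1 *m S).
Proof.
pose X := B2 - B1 *m S + S.
have -> : block_mx B1 B2 1%:M S = block_mx 1%:M (B1 - 1%:M) 0 1%:M *m
    (block_mx 1%:M 0 1%:M 1%:M *m block_mx 1%:M X 0 (S - X)).
  rewrite !mulmx_block !(mul1mx, mul0mx, mulmx1, mulmx0, add0r, addr0).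
  rewrite [X + (S - X)]addrC subrK.
  rewrite [1%:M + (B1 - 1%:M)]addrC subrK; congr block_mx.
  by rewrite mulmxBl mul1mx /X -addrA [S + _]addrC !subrK.
rewrite !det_mulmx det_ublock det_lblock det_ublock !det1 !mul1r.
by rewrite /X opprD addrCA subrr addr0 -scaleN1r detZ sqrrN expr1n mul1r.
Qed.

End BlockDet.

Section WhiteheadTorsion.
Variable F : fieldType.
Variable rho : 'I_2 -> 'M[F]_2.

Let M := contragredient rho ord0.
Let U := contragredient rho ord_max.

Hypothesis rep : is_rep whitehead rho.

Let d : forall i, \det (rho i) = 1 := rep.1.
Let d' := contragredient_det d.

Lemma contragredient_rep : is_rep whitehead (contragredient rho).
Proof.
split=> // w wP; rewrite word_mx_contragredient // (word_mx_winv d) rep.2 //.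
by rewrite invr1 trmx1.
Qed.

Lemma contragredient_trace :
  [/\ \tr M = \tr (rho ord0), \tr U = \tr (rho ord_max)
    & \tr (M * U) = \tr (rho ord0 * rho ord_max)].
Proof.
have trV (A : 'M[F]_2) : \det A = 1 -> \tr (A^-1)^T = \tr A.
  by move=> dA; rewrite mxtrace_tr sl2_inv //
    raddfB /= mxtrace_scalar mulr2n addrK.
split; [exact: trV | exact: trV | ].
have dMU : \det (rho ord0 * rho ord_max) = 1.
  by rewrite -mulmxE det_mulmx !d mulr1.
rewrite -(trV _ dMU) invrM ?(sl2_unit (d _)) // -!mulmxE trmx_mul.
by rewrite -trmx_mul mxtrace_tr mxtrace_mulC -mxtrace_tr trmx_mul.
Qed.

Lemma fox_mx_w0 : fox_mx (contragredient rho) ord0 wl_w = w_fox_m M U.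
Proof.
rewrite /fox_mx /zword_mx /= !big_cons big_nil /= !mulmx1 !mulrN1z !mulr1z
  addr0.
by rewrite addrA.
Qed.

Lemma fox_mx_w1 : fox_mx (contragredient rho) ord_max wl_w = w_fox_mu M U.
Proof.
rewrite /fox_mx /zword_mx /= !big_cons big_nil /= !mulmx1 !mulrN1z !mulr1z
  addr0.
by rewrite !addrA.
Qed.

(** The first half of the relator m w m^-1 w^-1 contributes dm + m dw, and the
    second half - w dm - dw, because m and w commute. *)
Lemma fox_mx_relator j :
  fox_mx (contragredient rho) j whitehead_relator =
    (1 - w_mx M U) * fox_mx (contragredient rho) j wl_m
      + (M - 1) * fox_mx (contragredient rho) j wl_w.
Proof.
have [_ comm] := (is_rep_whitehead _).1 contragredient_rep.
have uM : M \is a GRing.unit := sl2_unit (d' _).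
have uW : w_mx M U \is a GRing.unit by rewrite /M /U -word_mx_w word_mx_unit.
rewrite /whitehead_relator (fox_mx_cat _ _ wl_m) (fox_mx_cat _ _ wl_w)
  (fox_mx_cat _ _ (winv wl_m)).
rewrite !(fox_mx_winv d') (word_mx_winv d') word_mx_w -/M -/U.
have -> : word_mx (contragredient rho) wl_m = M by rewrite /= mulmx1.
rewrite -/M -/U in comm; move: (w_mx M U) comm uW => W comm uW.
move: (fox_mx _ j wl_m) (fox_mx _ j wl_w) => f g.
rewrite !mulrDr !mulNr !mulrN !mulrA comm mulrK // divrr //
  mul1r !mulrBl !mul1r.
by rewrite -!addrA; congr (f + _); apply: addrCA.
Qed.

Lemma fox_mx_relator_m :
  fox_mx (contragredient rho) ord0 whitehead_relator = relator_fox_m M U.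
Proof. by rewrite fox_mx_relator fox_mx_letter /= mulr1 fox_mx_w0. Qed.

Lemma fox_mx_relator_mu :
  fox_mx (contragredient rho) ord_max whitehead_relator =
    (M - 1) * w_fox_mu M U.
Proof. by rewrite fox_mx_relator fox_mx_letter /= mulr0 add0r fox_mx_w1. Qed.

End WhiteheadTorsion.

Section WhiteheadTorsionValue.
Variable F : fieldType.
Variable rho : 'I_2 -> 'M[F]_2.
Hypothesis rep : is_rep whitehead rho.

Let M := contragredient rho ord0.
Let U := contragredient rho ord_max.
Let bd := twisted_bd whitehead rho.
Let dim := twisted_dim whitehead.

Lemma dim0 : 2 = dim 0%N. Proof. by rewrite /dim /twisted_dim big_ord1. Qed.

Lemma dim1 : (2 + 2)%N = dim 1%N.
Proof. by rewrite /dim /twisted_dim big_ord_recl big_ord1. Qed.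

Lemma dim2 : 2 = dim 2%N. Proof. by rewrite /dim /twisted_dim big_ord1. Qed.

Lemma dim3 i : dim i.+3 = 0%N.
Proof. by rewrite /dim /twisted_dim big_ord0. Qed.

Lemma twisted_bd0 : bd 0%N = castmx (dim1, dim0) (col_mx (M - 1) (U - 1)).
Proof.
have letterE i : (dual_action rho [:: (1, gen i); (-1, [::])])^T =
    contragredient rho i - 1.
  rewrite (dual_action_tr rep.1) /zword_mx !big_cons big_nil /= addr0 mulmx1.
  by rewrite mulr1z mulrN1z.
have := mxblock21E (fun (a : 'I_2) (c : 'I_1) =>
  (dual_action rho [:: (1, gen a); (-1, [::])])^T) dim0 dim1.
rewrite !letterE => E; rewrite /bd /twisted_bd E; congr castmx.
by congr (col_mx (contragredient _ _ - 1) (contragredient _ _ - 1));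
  apply: val_inj.
Qed.

Lemma twisted_bd1 :
  bd 1%N = castmx (dim2, dim1)
             (row_mx (relator_fox_m M U) ((M - 1) * w_fox_mu M U)).
Proof.
have relE c : (dual_action rho (fox c (nth [::] whitehead 0)))^T =
   fox_mx (contragredient rho) c whitehead_relator.
  by rewrite (dual_action_tr rep.1).
have := mxblock12E (fun (a : 'I_1) (c : 'I_2) =>
  (dual_action rho (fox c (nth [::] whitehead a)))^T) dim2 dim1.
rewrite [X in row_mx X _]relE [X in row_mx _ X]relE => E.
rewrite /bd /twisted_bd E.
have -> : 1 = ord_max :> 'I_2 by apply: val_inj.
have -> : 0 = ord0 :> 'I_2 by apply: val_inj.
by rewrite (fox_mx_relator_m rep) (fox_mx_relator_mu rep).
Qed.

Let x := \tr (rho ord0).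
Let y := \tr (rho ord_max).
Let z := \tr (rho ord0 * rho ord_max).

Hypothesis riley0 : riley x y z = 0.

(** The rows (S1, S2) are the Fox derivatives of a word h, so that
    S1 (m - 1) + S2 (mu - 1) = h - 1, whose determinant is 2 - Tr h.  The words
    are m, mu and m mu: for each of them the denominator vanishes at some
    irreducible characters. *)
Lemma whitehead_block_det k : k \in [:: 2 - x; 2 - y; 2 - z] ->
  exists S1 S2 : 'M[F]_2,
    \det (S1 *m (M - 1) + S2 *m (U - 1)) = k /\
    \det (block_mx (relator_fox_m M U) ((M - 1) * w_fox_mu M U) S1 S2) =
      torsion_poly x y z * k.
Proof.
have dM : \det M = 1 := contragredient_det rep.1 _.
have dU : \det U = 1 := contragredient_det rep.1 _.
have [tM tU tMU] := contragredient_trace rep.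
have f0 : riley (\tr M) (\tr U) (\tr (M * U)) = 0 by rewrite tM tU tMU.
rewrite !inE => /or3P[]/eqP->.
- exists 1%:M, 0; rewrite mul1mx mul0mx addr0 det_subr1 // tM; split=> //.
  rewrite det_block_1l mulmx0 subr0 -mulmxE det_mulmx det_subr1 //
    det_w_fox_mu //.
  by rewrite tM tU tMU mulrC.
- exists 0, 1%:M; rewrite mul1mx mul0mx add0r det_subr1 // tU; split=> //.
  by rewrite det_ublock det1 mulr1 det_relator_fox_m // tM tU tMU.
exists 1%:M, M; have -> : 1%:M *m (M - 1) + M *m (U - 1) = M * U - 1.
  by rewrite mul1mx mulmxE mulrBr mulr1 addrC addrA subrK.
rewrite det_subr1 ?tMU; last by rewrite -mulmxE det_mulmx dM dU mulr1.
by split=> //; rewrite det_block_1l mulmxE det_relator_fox_sum // tM tU tMU.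
Qed.

Hypothesis irr : reducible_locus x y z != 0.

(** The point x = y = z = 2 is the trivial character, which is reducible. *)
Lemma traces_neq2 : exists2 k, k \in [:: 2 - x; 2 - y; 2 - z] & k != 0.
Proof.
apply/hasP; apply: contraNT irr; rewrite /= orbF !negb_or !negbK !subr_eq0.
case/and3P => /eqP<- /eqP<- /eqP<-.
by apply/eqP; rewrite /reducible_locus; ring.
Qed.

Lemma whitehead_torsionE t :
  acyclic_rep whitehead rho -> rep_torsion whitehead rho t ->
  t = torsion_poly x y z.
Proof.
move=> acy tv; have [k k_in k0] := traces_neq2.
have [S1 [S2 [dS dB]]] := whitehead_block_det k_in.
have [/(_ t acy tv) E _] :=
  acyclic_block_complex S1 S2 twisted_bd0 twisted_bd1 dim3.
by apply: (mulIf k0); rewrite -dB -E dS.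
Qed.

Lemma whitehead_acyclic :
  torsion_poly x y z != 0 -> acyclic_rep whitehead rho.
Proof.
move=> t0; have [k k_in k0] := traces_neq2.
have [S1 [S2 [dS dB]]] := whitehead_block_det k_in.
have [_] := acyclic_block_complex S1 S2 twisted_bd0 twisted_bd1 dim3.
apply; rewrite ?dS ?dB //; last by rewrite mulf_neq0.
have := fox_mx_fundamental (contragredient_det rep.1) whitehead_relator.
rewrite (contragredient_rep rep).2 ?mem_head // subrr.
rewrite !big_ord_recl big_ord0 addr0.
have -> : fintype.lift ord0 ord0 = ord_max :> 'I_2 by apply: val_inj.
by rewrite (fox_mx_relator_m rep) (fox_mx_relator_mu rep).
Qed.

End WhiteheadTorsionValue.

(** * Polynomial functions *)

Section PolynomialFunctions.
Variables (F : fieldType) (n : nat).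

Lemma mpoly_ring_ind (P : {mpoly F[n]} -> Prop) :
  (forall c, P c%:MP) -> (forall i, P 'X_i) ->
  (forall p q, P p -> P q -> P (p + q)) ->
  (forall p q, P p -> P q -> P (p * q)) ->
  forall p, P p.
Proof.
move=> PC PX PD PM p; rewrite (mpolyE p).
apply: big_ind => [|//|m _]; first by rewrite -mpolyC0; apply: PC.
rewrite -mul_mpolyC; apply: (PM) => //; rewrite mpolyXE_id.
apply: big_ind => [|//|i _]; first by rewrite -mpolyC1; apply: PC.
by elim: (m i) => [|k IH]; [rewrite expr0 -mpolyC1; apply: PC | rewrite exprS;
  apply: PM].
Qed.

Definition polyfun (phi : 'rV[F]_n -> F) :=
  exists p : {mpoly F[n]}, forall v, ev p v = phi v.

Lemma polyfun_ev p : polyfun (ev p). Proof. by exists p. Qed.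

Lemma polyfunC c : polyfun (fun=> c).
Proof. by exists c%:MP => v; rewrite /ev mevalC. Qed.

Lemma polyfunX i : polyfun (fun v => v 0 i).
Proof. by exists 'X_i => v; rewrite /ev mevalXU. Qed.

Lemma polyfunD f g : polyfun f -> polyfun g -> polyfun (fun v => f v + g v).
Proof.
move=> [p pE] [q qE]; exists (p + q) => v.
by rewrite /ev mevalD -/(ev p v) pE -qE.
Qed.

Lemma polyfunN f : polyfun f -> polyfun (fun v => - f v).
Proof.
by move=> [p pE]; exists (- p) => v; rewrite /ev mevalN -/(ev p v) pE.
Qed.

Lemma polyfunM f g : polyfun f -> polyfun g -> polyfun (fun v => f v * g v).
Proof.
move=> [p pE] [q qE]; exists (p * q) => v.
by rewrite /ev mevalM -/(ev p v) pE -qE.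
Qed.

Lemma polyfunXn f k : polyfun f -> polyfun (fun v => f v ^+ k).
Proof.
move=> [p pE]; exists (p ^+ k) => v.
by rewrite /ev rmorphXn /= -/(ev p v) pE.
Qed.

(** Along a curve with coordinates a_i / d, a polynomial becomes a polynomial in
    the parameter after multiplication by a power of d. *)
Lemma polyfun_curve p (a : 'I_n -> {poly F}) (d : {poly F}) :
  exists q N, forall e, d.[e] != 0 ->
    q.[e] = d.[e] ^+ N * ev p (\row_i ((a i).[e] / d.[e])).
Proof.
elim/mpoly_ring_ind: p =>
  [c|i|p1 p2 [q1 [N1 E1]] [q2 [N2 E2]]|p1 p2 [q1 [N1 E1]] [q2 [N2 E2]]].
- by exists c%:P, 0%N => e _; rewrite hornerC /ev mevalC expr0 mul1r.
- by exists (a i), 1%N => e d0; rewrite /ev mevalXU mxE mulrCA divff ?mulr1.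
- exists (q1 * d ^+ N2 + q2 * d ^+ N1), (N1 + N2)%N => e d0.
  by rewrite !hornerE E1 // E2 // /ev mevalD exprD mulrDr; ring.
- exists (q1 * q2), (N1 + N2)%N => e d0.
  by rewrite !hornerE E1 // E2 // /ev mevalM exprD; ring.
Qed.

End PolynomialFunctions.

Ltac polyfun := repeat first
  [ exact: polyfun_ev | exact: polyfunX | exact: polyfunC | apply: polyfunD
  | apply: polyfunN | apply: polyfunM | apply: polyfunXn ].

(** * The curve of characters of the surgery *)

Section Line.
Variable F : numClosedFieldType.
Notation pt := 'rV[F]_3.
Implicit Types (v w : pt) (p h : {mpoly F[3]}) (k : F).

Notation X := (Xirr F whitehead).
Notation Y := (Xirr F (whitehead_surgery (-3) 1 (-3) 1)).

Definition cx v := v 0 0.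
Definition cy v := v 0 1.
Definition cz v := v 0 ord_max.

Lemma Xirr_whitehead_coordP v : X v <->
  riley (cx v) (cy v) (cz v) = 0 /\ reducible_locus (cx v) (cy v) (cz v) != 0.
Proof. by rewrite [v in X v]pt3_eta; apply: Xirr_whiteheadP. Qed.

Lemma Xirr_surgery_coordP v : Y v <-> [/\ cz v = -1, cx v + cy v = 1 &
  reducible_locus (cx v) (cy v) (cz v) != 0].
Proof. by rewrite [v in Y v]pt3_eta; apply: Xirr_surgeryP. Qed.

Lemma pt3E (x y z : F) :
  (cx (pt3 x y z) = x) * (cy (pt3 x y z) = y) * (cz (pt3 x y z) = z).
Proof. by rewrite /cx /cy /cz !mxE. Qed.

Lemma curve_sub v : Y v -> X v.
Proof.
move/Xirr_surgery_coordP => [ez exy g0]; apply/Xirr_whitehead_coordP.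
split=> //; have ey : cy v = 1 - cx v by rewrite -exy; ring.
by rewrite /riley ez ey; ring.
Qed.

Definition off_line v := cx v + cy v - 1.
Definition torsion_at v := torsion_poly (cx v) (cy v) (cz v).

(** On the plane z = x + y - 2 one has (x + y - 1)^2 g = - (x + y) riley. *)
Lemma torsion_at_eq0 v : X v -> torsion_at v = 0 <-> Y v.
Proof.
move=> /Xirr_whitehead_coordP[f0 g0]; split=>
  [t0|/Xirr_surgery_coordP[ez exy _]]; last first.
  by rewrite /torsion_at /torsion_poly ez -addrA -opprD exy; ring.
have two0 : (2 : F) != 0 by rewrite pnatr_eq0.
have {t0} ez : cz v = cx v + cy v - 2.
  move/eqP: t0; rewrite /torsion_at /torsion_poly mulf_eq0 (negPf two0) /= =>
    /eqP t0.
  by apply/eqP; rewrite -subr_eq0 -t0; apply/eqP; ring.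
apply/Xirr_surgery_coordP.
have : (cx v + cy v - 1) ^+ 2 * reducible_locus (cx v) (cy v) (cz v) = 0.
  transitivity (- (cx v + cy v) * riley (cx v) (cy v) (cz v)).
    by rewrite /riley /reducible_locus ez; ring.
  by rewrite f0 mulr0.
move/eqP; rewrite mulf_eq0 (negPf g0) orbF sqrf_eq0 subr_eq0 => /eqP s1.
by split=> //; rewrite ez s1; ring.
Qed.

(** The line z = -1, x + y = 1, parametrized by x. *)
Definition line k : pt := pt3 k (1 - k) (-1).

Lemma line_cx v : Y v -> v = line (cx v).
Proof.
move/Xirr_surgery_coordP => [ez exy _].
have ey : cy v = 1 - cx v by rewrite -exy; ring.
by rewrite [LHS]pt3_eta -/(cx v) -/(cy v) -/(cz v) ez ey.
Qed.

Lemma curve_line k : Y (line k) <-> (k - 2) * (k + 1) != 0.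
Proof.
have -> : (k - 2) * (k + 1) = reducible_locus k (1 - k) (-1).
  by rewrite /reducible_locus; ring.
split=> [/Xirr_surgery_coordP[_ _]|g0]; first by rewrite !pt3E.
by apply/Xirr_surgery_coordP; rewrite !pt3E; split=> //; ring.
Qed.

Lemma curve_line0 : Y (line 0).
Proof. by apply/curve_line; rewrite !add0r mulr1 oppr_eq0 pnatr_eq0. Qed.

Lemma curve_line1 : Y (line 1).
Proof.
apply/curve_line; rewrite (_ : _ * _ = - 2%:R); last by ring.
by rewrite oppr_eq0 pnatr_eq0.
Qed.

Lemma ev_line p : exists q : {poly F}, forall k, q.[k] = ev p (line k).
Proof.
have [q [N E]] := polyfun_curve p (fun i : 'I_3 => [:: 'X; 1 - 'X; -1]`_i) 1.
exists q => k; rewrite E hornerC ?oner_eq0 // expr1n mul1r; congr (ev p _).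
by apply/rowP => i; rewrite !mxE divr1; case: i => [[|[|[|//]]] ?];
  rewrite /= !hornerE.
Qed.

(** The curve is irreducible: restricted to the line, p and h become nonzero
    polynomials in one variable, and so does the equation of the two points that
    are removed from the line. *)
Lemma curve_common_nonzero p h :
  (exists2 v, Y v & ev p v != 0) -> (exists2 v, Y v & ev h v != 0) ->
  exists v, [/\ Y v, ev p v != 0 & ev h v != 0].
Proof.
move=> [v Yv pv] [w Yw hw].
have [qp Ep] := ev_line p; have [qh Eh] := ev_line h.
pose q := qp * qh * (('X - 2%:P) * ('X + 1%:P)).
have : q != 0.
  rewrite !mulf_neq0 //.
  - by apply: contraNneq pv => q0; rewrite (line_cx Yv) -Ep q0 horner0.
  - by apply: contraNneq hw => q0; rewrite (line_cx Yw) -Eh q0 horner0.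
  - by rewrite -size_poly_gt0 size_XsubC.
  - by rewrite -size_poly_gt0 size_XaddC.
case/closed_nonrootP => k; rewrite /root !hornerE Ep Eh.
rewrite !mulf_eq0 !negb_or => /andP[/andP[/andP[p0 h0] k2] k1].
by exists (line k); split=> //; apply/curve_line; rewrite mulf_neq0.
Qed.

Lemma vanish_on_line p h : (exists2 v, Y v & ev h v != 0) ->
  (forall v, Y v -> ev h v != 0 -> ev p v = 0) -> forall k, ev p (line k) = 0.
Proof.
move=> h0 ph0 k; apply/eqP; apply: contraT => pk.
have [qp Ep] := ev_line p.
have : qp * (('X - 2%:P) * ('X + 1%:P)) != 0.
  rewrite !mulf_neq0 // -?size_poly_gt0 ?size_XsubC ?size_XaddC //.
  by rewrite size_poly_gt0; apply: contraNneq pk => q0; rewrite -Ep q0 horner0.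
case/closed_nonrootP => j; rewrite /root !hornerE Ep !mulf_eq0 !negb_or =>
  /andP[/andP[pj j2] j1].
have [|v [Yv pv hv]] := @curve_common_nonzero p h _ h0.
  by exists (line j) => //; apply/curve_line; rewrite mulf_neq0.
by rewrite ph0 ?eqxx in pv.
Qed.

End Line.

(** * The surface near the curve *)

Section Density.
Variable F : numClosedFieldType.
Notation pt := 'rV[F]_3.
Implicit Types (v w : pt) (p h : {mpoly F[3]}) (k : F).
Notation X := (Xirr F whitehead).
Notation Y := (Xirr F (whitehead_surgery (-3) 1 (-3) 1)).

(** The surface is a conic bundle over the z-line:
      riley = - z ((x - z y) (x - y / z) + z^2 - 2).
    With t = x - z y, the equation can be solved for y, hence for x, in terms of
    z and t.  For e = 0 the rational curve z = -1 + e, t = 1 + k e passes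
    through the point of the line with x = k, and x + y - 1 = e (k + y) on it,
    with k + y = 1 at e = 0.  A polynomial that is nonzero at e = 0 is
    nonzero for almost all e. *)
Lemma exists_off_curve p v : Y v -> ev p v != 0 ->
  exists w, [/\ X w, off_line w != 0 & ev p w != 0].
Proof.
move=> Yv pv; set k := cx v.
have vE : v = line k := line_cx Yv.
have [G GE] : polyfun (fun v => reducible_locus (cx v) (cy v) (cz v)).
  by rewrite /reducible_locus /cx /cy /cz; polyfun.
have [D DE] : exists D : {poly F}, forall e, D.[e] = (1 + k * e) * (e - 2).
  by exists ((1 + k *: 'X) * ('X - 2%:P)) => e; rewrite !hornerE.
have [N NE] : exists N : {poly F}, forall e,
    N.[e] = (e - 1) * ((2 - 2 * k) - (1 + k ^+ 2) * e).
  exists (('X - 1) * ((2 - 2 * k)%:P - (1 + k ^+ 2) *: 'X)) => e.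
  by rewrite !hornerE.
have [Px PxE] : exists P : {poly F}, forall e,
    P.[e] = (1 + k * e) * D.[e] + (e - 1) * N.[e].
  by exists ((1 + k *: 'X) * D + ('X - 1) * N) => e; rewrite !hornerE.
have [Pz PzE] : exists P : {poly F}, forall e, P.[e] = (e - 1) * D.[e].
  by exists (('X - 1) * D) => e; rewrite !hornerE.
pose a (i : 'I_3) : {poly F} := [:: Px; N; Pz]`_i.
pose w e : pt :=
  pt3 ((1 + k * e) + (e - 1) * (N.[e] / D.[e])) (N.[e] / D.[e]) (e - 1).
have [q [d qE]] := polyfun_curve (p * G) a D.
have wE e : D.[e] != 0 -> \row_i ((a i).[e] / D.[e]) = w e.
  move=> De; apply/rowP => i; rewrite !mxE /a.
  by case: i => [[|[|[|//]]] ?]; rewrite /= ?PxE ?PzE //; field.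
have D0 : D.[0] = -2 by rewrite DE; ring.
have N0 : N.[0] = 2 * k - 2 by rewrite NE; ring.
have two0 : (2 : F) != 0 by rewrite pnatr_eq0.
have Dn0 : D.[0] != 0 by rewrite D0 oppr_eq0.
have w0 : w 0 = v.
  rewrite vE /w /line D0 N0; congr pt3; first by field.
    by field.
  by ring.
(* A root of r is a parameter at which p or g vanishes, x + y = 1, or the
   parametrization is undefined. *)
pose r := q * 'X * D * (k *: D + N).
have : r != 0.
  have n0 (s : {poly F}) : s.[0] != 0 -> s != 0.
    by apply: contraNneq => ->; rewrite horner0.
  rewrite !mulf_neq0 ?polyX_eq0 ?n0 //.
    rewrite qE // wE // w0 mulf_neq0 ?expf_neq0 // /ev mevalM mulf_neq0 //.
    by rewrite -/(ev G v) GE; move/Xirr_surgery_coordP: Yv => [].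
  rewrite !hornerE D0 N0 (_ : _ + _ = - 2%:R) ?oppr_eq0 //; ring.
case/closed_nonrootP => e; rewrite /root !hornerE.
rewrite !mulf_eq0 !negb_or => /andP[/andP[/andP[qe e0] De] s0].
have := qe; rewrite qE // mulf_eq0 negb_or wE // => /andP[_].
rewrite /ev mevalM mulf_eq0 negb_or -/(ev G _) GE => /andP[pw gw].
exists (w e); split=> //.
  apply/Xirr_whitehead_coordP; split=> //; rewrite !pt3E NE DE /riley.
  move: De; rewrite DE mulf_eq0 negb_or => /andP[m0 n0].
  by field; rewrite m0 n0.
apply: contraNneq (mulf_neq0 e0 s0) => t0; apply/eqP.
rewrite -[RHS](mulr0 (D.[e])) -t0 /off_line !pt3E; field.
exact: De.
Qed.

(** The torsion is twice this function. *)
Definition off_plane v := cz v + 2 - cx v - cy v.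

(** On the line this is - g. *)
Definition reducible_factor v : F := (cx v - 2) * (cy v - 2).

(** The cofactor H in
    riley = (x + y - 1)^2 (x - 2) (y - 2) + (2 + z - x - y) H. *)
Definition transverse_factor v : F :=
  let x := cx v in let y := cy v in let z := cz v in
  - z ^+ 2 + x * y * z - y * z - x * z + 2 * z + x * y ^+ 2 + x ^+ 2 * y
  - 2 * y ^+ 2 - 4 * x * y - 2 * x ^+ 2 + 4 * y + 4 * x - 2.

Lemma riley_along_curve v : X v ->
  off_plane v * transverse_factor v = - off_line v ^+ 2 * reducible_factor v.
Proof.
move=> /Xirr_whitehead_coordP[f0 _]; apply/eqP; rewrite -subr_eq0 -f0;
  apply/eqP.
by rewrite /riley /off_plane /transverse_factor /off_line /reducible_factor;
  ring.
Qed.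

Lemma transverse_factor_curve v : Y v -> transverse_factor v = -2.
Proof.
by move=> Yv; rewrite (line_cx Yv) /transverse_factor /line !pt3E; ring.
Qed.

Lemma reducible_factor_curve v : Y v -> reducible_factor v != 0.
Proof.
move=> Yv; have /Xirr_surgery_coordP[_ _] := Yv;
  rewrite (line_cx Yv) /reducible_factor /line !pt3E.
by apply: contraNneq => c0; rewrite -[X in _ == X]oppr0 -c0 /reducible_locus;
  apply/eqP; ring.
Qed.

(** The functions [off_plane] and [off_line] generate the ideal of the line, and
    (x, 1 - x, -1) is the projection of a point onto the line. *)
Lemma line_division p : exists a b, forall v,
  ev p v = ev a v * off_plane v + ev b v * off_line v + ev p (line (cx v)).
Proof.
elim/mpoly_ring_ind: p =>
  [c|i|p q [a [b E]] [a' [b' E']]|p q [a [b E]] [a' [b' E']]].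
- by exists 0, 0 => v; rewrite /ev !meval0 !mevalC; ring.
- have [->|[->|->]] : i = 0 \/ i = 1 \/ i = ord_max.
    by case: i => [[|[|[|//]]] ?]; [left | right; left | right; right];
      apply: val_inj.
  + by exists 0, 0 => v; rewrite /ev !meval0 !mevalXU -![_ 0 0]/(cx _) !pt3E;
      ring.
  + exists 0, 1 => v; rewrite /ev meval0 meval1 !mevalXU -![_ 0 1]/(cy _)
      !pt3E /off_line; ring.
  + exists 1, 1 => v; rewrite /ev meval1 !mevalXU -![_ 0 ord_max]/(cz _) !pt3E
      /off_line /off_plane; ring.
- exists (a + a'), (b + b') => v; move: (E v) (E' v); rewrite /ev !mevalD =>
    -> ->; ring.
(* With p0, q0 the values on the line, p q - p0 q0 = (p - p0) q + p0 (q - q0),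
   and p0 is eliminated by the division of p. *)
have [A AE] : polyfun (fun v => ev a v * ev q v
    + (ev p v - ev a v * off_plane v - ev b v * off_line v) * ev a' v).
  by rewrite /off_plane /off_line /cx /cy /cz; polyfun.
have [B BE] : polyfun (fun v => ev b v * ev q v
    + (ev p v - ev a v * off_plane v - ev b v * off_line v) * ev b' v).
  by rewrite /off_plane /off_line /cx /cy /cz; polyfun.
exists A, B => v; rewrite AE BE.
have M u : ev (p * q) u = ev p u * ev q u by rewrite /ev mevalM.
rewrite !M; move: (E v) (E' v) => -> ->; ring.
Qed.

End Density.

(** * Germs along the curve and the order of vanishing *)

Section Germs.
Variable F : numClosedFieldType.
Notation pt := 'rV[F]_3.
Implicit Types (v w : pt) (p h f : {mpoly F[3]}) (k : F).
Notation X := (Xirr F whitehead).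
Notation Y := (Xirr F (whitehead_surgery (-3) 1 (-3) 1)).

Lemma two_neq0 : (2 : F) != 0. Proof. by rewrite pnatr_eq0. Qed.

Lemma off_line_curve v : Y v -> off_line v = 0.
Proof.
by case/Xirr_surgery_coordP => [_ exy _]; rewrite /off_line exy subrr.
Qed.

Lemma transverse_factor_neq0 v : Y v -> transverse_factor v != 0.
Proof. by move/transverse_factor_curve->; rewrite oppr_eq0 two_neq0. Qed.

Lemma polyfun_transverse_factor : polyfun (@transverse_factor F).
Proof. by rewrite /transverse_factor /cx /cy /cz; polyfun. Qed.

(** A polynomial that vanishes on the curve is a off_plane + b off_line, and on
    the surface off_plane H is a multiple of off_line^2.  The factor H is
    invertible along the curve, so this says that off_line generates the maximal
    ideal. *)
Lemma factor_off_line p h : (exists2 v, Y v & ev h v != 0) ->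
  (forall v, Y v -> ev h v != 0 -> ev p v = 0) ->
  exists n, forall w, X w -> ev p w * transverse_factor w = ev n w * off_line w.
Proof.
move=> h0 ph0; have p0 := vanish_on_line h0 ph0.
have [a [b pE]] := line_division p.
have [n nE] : polyfun (fun w => ev b w * transverse_factor w
    - ev a w * (off_line w * reducible_factor w)).
  by rewrite /transverse_factor /off_line /reducible_factor /cx /cy /cz;
    polyfun.
exists n => w Xw; rewrite nE pE p0 addr0 mulrDl -mulrA riley_along_curve //;
  ring.
Qed.

(** The points of the surface with x + y <> 1 accumulate on the curve. *)
Lemma vanish_on_curve p h :
  (forall w, X w -> off_line w != 0 -> ev h w != 0 -> ev p w = 0) ->
  forall v, Y v -> ev h v != 0 -> ev p v = 0.
Proof.
move=> p0 v Yv hv; apply/eqP; apply: contraT => pv.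
have [|w [Xw tw]] := @exists_off_curve _ (p * h) v Yv.
  by rewrite /ev mevalM mulf_neq0.
rewrite /ev mevalM mulf_eq0 negb_or => /andP[pw hw].
by rewrite -/(ev p w) p0 ?eqxx in pw.
Qed.

Lemma off_line_uniformizer : uniformizer X Y (@off_line F).
Proof.
have [T TE] : polyfun (@off_line F) by rewrite /off_line /cx /cy /cz; polyfun.
have [H HE] := polyfun_transverse_factor.
have one v : ev (1 : {mpoly F[3]}) v = 1 by rewrite /ev meval1.
have Y1 : exists2 v : pt, Y v & ev (1 : {mpoly F[3]}) v != 0.
  by exists (line 0); [exact: curve_line0 | rewrite one oner_neq0].
split.
- split; [exists T, 1; split=> // w _ _; by rewrite one divr1 TE | ].
  by exists 1; split=> // w _ _; apply: off_line_curve.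
- move=> [h [[v Yv hv] H0]].
  have [w [Xw tw hw]] := exists_off_curve Yv hv.
  by rewrite H0 ?eqxx in tw.
move=> phi [[f [h [Yh fE]]] [h' [Yh' phi0]]].
have [[v Yv hv] [v' Yv' hv']] := (Yh, Yh').
have [u [Yu hu hu']] := curve_common_nonzero Yh Yh'.
have Yhh' : exists2 v : pt, Y v & ev (h * h') v != 0.
  by exists u => //; rewrite /ev mevalM mulf_neq0.
have [|n nE] := @factor_off_line f (h * h') Yhh'.
  move=> w Yw; rewrite /ev mevalM mulf_eq0 negb_or => /andP[hw hw'].
  have := fE _ (curve_sub Yw) hw; rewrite (phi0 w (curve_sub Yw) hw' Yw) =>
    /esym/eqP.
  by rewrite mulf_eq0 invr_eq0 (negPf hw) orbF => /eqP.
exists (fun w => ev n w / ev (h * H) w).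
  exists n, (h * H); split=> //; exists v => //.
  by rewrite /ev mevalM mulf_neq0 // -/(ev H v) HE transverse_factor_neq0.
exists (h * H); split.
  exists v => //.
  by rewrite /ev mevalM mulf_neq0 // -/(ev H v) HE transverse_factor_neq0.
move=> w Xw; rewrite /ev mevalM -/(ev h w) -/(ev H w) HE mulf_eq0 negb_or =>
  /andP[hw Hw].
rewrite fE // mulrAC -[X in _ = X / _]nE //; field; rewrite ?hw ?Hw //.
Qed.

Section TorsionFunction.
Variable tau : pt -> F.
Hypothesis tauP : torsion_function F tau.

(** Off the curve all characters are acyclic, but the sign of a torsion function
    may depend on the point: only the square is determined. *)
Lemma tau_sqr_off_curve w : X w -> ~ Y w -> tau w ^+ 2 = torsion_at w ^+ 2.
Proof.
move=> Xw nYw; have [rho [rep irr wE]] := Xw.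
have e := char_ptE rho; rewrite -wE [LHS]pt3_eta in e.
have [ex ey ez] := pt3_inj e.
rewrite -/(cx w) -/(cy w) -/(cz w) in ex ey ez.
have [f0 g0] := (Xirr_whitehead_coordP w).1 Xw.
rewrite ex ey ez in f0 g0.
have t0 : torsion_at w != 0.
  by apply/eqP => /(torsion_at_eq0 Xw).
have acy : acyclic_rep whitehead rho.
  by apply: whitehead_acyclic => //; rewrite -ex -ey -ez.
have [t tv] := torsion_value_exists (twisted_bd whitehead rho) 2.
have tE := whitehead_torsionE rep f0 g0 acy tv.
have := tauP.2 rho rep irr acy t tv; rewrite -wE tE /torsion_at ex ey ez.
by case=> ->; rewrite ?sqrrN.
Qed.

Lemma tau_curve w : Y w -> tau w = 0.
Proof.
move=> Yw; have [f [h [hw tauE]]] := tauP.1 w (curve_sub Yw).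
have [p pE] : polyfun (fun v => ev f v ^+ 2 - ev h v ^+ 2 * torsion_at v ^+ 2).
  by rewrite /torsion_at /torsion_poly /cx /cy /cz; polyfun.
have : ev p w = 0.
  apply: (@vanish_on_curve p h) => // v Xv tv hv;
    rewrite pE -tau_sqr_off_curve //; last by move/off_line_curve/eqP;
    rewrite (negPf tv).
  rewrite tauE //.
  by field.
rewrite pE (torsion_at_eq0 (curve_sub Yw)).2 // expr0n mulr0 subr0 => /eqP.
by rewrite sqrf_eq0 (tauE _ (curve_sub Yw) hw) => /eqP->; rewrite mul0r.
Qed.

Lemma tau_zeros : X `&` [set v | tau v = 0] = Y.
Proof.
apply/seteqP; split=> [w [Xw /= tw]|w Yw]; last first.
  by split; [exact: curve_sub | exact: tau_curve].
apply: contrapT => nYw; apply: (nYw); apply/(torsion_at_eq0 Xw)/eqP.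
by rewrite -sqrf_eq0 -tau_sqr_off_curve // tw expr0n.
Qed.

(** Write tau = f / h near the curve and t for [off_line].  The square of tau is
    known, and t is not a zero divisor because the surface off the curve is
    dense.  So f H = n1 t with n1^2 = 4 h^2 t^2 c^2, where c = (x - 2) (y - 2);
    hence n1 vanishes on the curve and n1 H = n2 t with n2^2 = 4 h^2 c^2 H^2,
    which has no zeros on the curve where h is nonzero.  Therefore
    tau = n2 / (h H^2) t^2 with a unit n2 / (h H^2). *)
Lemma tau_order : vanishing_order X Y tau 2.
Proof.
have [H HE] := polyfun_transverse_factor.
have [f [h [h0 tauE]]] := tauP.1 _ (curve_sub (curve_line0 F)).
have Yh : exists2 v, Y v & ev h v != 0 by exists (line 0) => //;
  apply: curve_line0.
have sqr w : X w -> off_line w != 0 -> ev h w != 0 ->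
    ev f w ^+ 2 * transverse_factor w ^+ 2 = 4 * ev h w ^+ 2 * off_line w ^+ 4
      * reducible_factor w ^+ 2.
  move=> Xw tw hw; have nYw : ~ Y w by move/off_line_curve/eqP;
    rewrite (negPf tw).
  have fE : ev f w = tau w * ev h w by rewrite tauE // divfK.
  rewrite fE exprMn tau_sqr_off_curve //.
  transitivity (4 * ev h w ^+ 2 * (off_plane w * transverse_factor w) ^+ 2).
    by rewrite /torsion_at /torsion_poly /off_plane; ring.
  by rewrite riley_along_curve //; ring.
have [|n1 n1E] := factor_off_line Yh (p := f).
  move=> v Yv hv; have := tauE v (curve_sub Yv) hv; rewrite tau_curve // =>
    /esym/eqP.
  by rewrite mulf_eq0 invr_eq0 (negPf hv) orbF => /eqP.
have sqr1 w : X w -> off_line w != 0 -> ev h w != 0 ->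
    ev n1 w ^+ 2 = 4 * ev h w ^+ 2 * off_line w ^+ 2 * reducible_factor w ^+ 2.
  move=> Xw tw hw; apply: (mulIf (expf_neq0 2 tw)).
  by rewrite -exprMn -n1E // exprMn sqr //; ring.
have [|n2 n2E] := factor_off_line Yh (p := n1).
  have [p pE] : polyfun (fun w => ev n1 w ^+ 2
      - 4 * ev h w ^+ 2 * off_line w ^+ 2 * reducible_factor w ^+ 2).
    by rewrite /reducible_factor /off_line /cx /cy /cz; polyfun.
  move=> v Yv hv; have : ev p v = 0.
    by apply: (@vanish_on_curve p h) => // w Xw tw hw; rewrite pE sqr1 // subrr.
  by rewrite pE off_line_curve // expr0n mulr0 mul0r subr0 => /eqP;
    rewrite sqrf_eq0 => /eqP.
have sqr2 v : Y v -> ev h v != 0 -> ev n2 v != 0.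
  move=> Yv hv.
  have [p pE] : polyfun (fun w => ev n2 w ^+ 2
      - 4 * ev h w ^+ 2 * transverse_factor w ^+ 2 * reducible_factor w ^+ 2).
    by rewrite /transverse_factor /reducible_factor /cx /cy /cz; polyfun.
  have : ev p v = 0.
    apply: (@vanish_on_curve p h) => // w Xw tw hw; rewrite pE;
      apply: (mulIf (expf_neq0 2 tw)).
    by rewrite mul0r mulrBl -exprMn -n2E // exprMn sqr1 //; ring.
  rewrite pE => /eqP; rewrite subr_eq0 => /eqP n2sq.
  have [Hv cv] := (transverse_factor_neq0 Yv, reducible_factor_curve Yv).
  rewrite -sqrf_eq0 n2sq 3!mulf_eq0 !sqrf_eq0 (negPf hv) (negPf Hv) (negPf cv).
  by rewrite pnatr_eq0.
pose q := h * H * H.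
have qE w : ev q w = ev h w * transverse_factor w ^+ 2.
  by rewrite /q /ev !mevalM -!/(ev _ w) HE; ring.
have qY v : Y v -> ev h v != 0 -> ev q v != 0.
  by move=> Yv hv; rewrite qE mulf_neq0 // expf_neq0 // transverse_factor_neq0.
have Yq : exists2 v, Y v & ev q v != 0 by have [v Yv hv] := Yh; exists v => //;
  apply: qY.
exists (@off_line F), (fun w => ev n2 w / ev q w); split;
  first exact: off_line_uniformizer.
- split; first by exists n2, q.
  move=> [_ [h' [Yh' u0]]]; have [v [Yv hv hv']] := curve_common_nonzero Yh Yh'.
  have := u0 v (curve_sub Yv) hv' Yv => /eqP.
  by rewrite mulf_eq0 invr_eq0 (negPf (sqr2 _ Yv hv)) (negPf (qY _ Yv hv)).
exists q; split=> // w Xw; rewrite qE mulf_eq0 negb_or sqrf_eq0 => /andP[hw Hw].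
rewrite tauE //.
have fE : ev f w * transverse_factor w ^+ 2 = ev n2 w * off_line w ^+ 2.
  by rewrite !expr2 !mulrA n1E // mulrAC n2E.
by rewrite mulrAC -fE; field; rewrite hw Hw.
Qed.

End TorsionFunction.
End Germs.

(** * Irreducibility, dimension and the divisor *)

Section Curve.
Variable F : numClosedFieldType.
Notation pt := 'rV[F]_3.
Implicit Types (v w : pt) (p h f : {mpoly F[3]}) (k : F) (Z : set pt).
Notation X := (Xirr F whitehead).
Notation Y := (Xirr F (whitehead_surgery (-3) 1 (-3) 1)).

Lemma closed_in_separate (Z A : set pt) v : closed_in Z A -> Z v -> ~ A v ->
  exists p, ev p v != 0 /\ forall w, A w -> ev p w = 0.
Proof.
move=> [S ->] Zv nAv; apply: contrapT => nex; apply: nAv; split=> //= p Sp.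
apply/eqP; apply: contraT => pv; exfalso; apply: nex; exists p.
by split=> // w [_ /=]; move/(_ p Sp).
Qed.

Lemma irreducible_curve : irreducible_set Y.
Proof.
split; first by exists (line 0); apply: curve_line0.
move=> A B cA cB YAB; apply: contrapT => /not_orP[/existsNP[v nv]
  /existsNP[w nw]].
move/not_implyP: nv => [Yv nAv]; move/not_implyP: nw => [Yw nBw].
have [p [pv pA]] := closed_in_separate cA Yv nAv.
have [h [hw hB]] := closed_in_separate cB Yw nBw.
have [||u [Yu pu hu]] := @curve_common_nonzero _ p h;
  [by exists v | by exists w | ].
have [/pA|/hB] := YAB _ Yu => e; first by rewrite e eqxx in pu.
by rewrite e eqxx in hu.
Qed.

Lemma closed_in_curve : closed_in X Y.
Proof.
have [p pE] : polyfun (fun v : pt => cz v + 1) by rewrite /cz; polyfun.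
have [q qE] : polyfun (@off_line F) by rewrite /off_line /cx /cy; polyfun.
exists [set r | r = p \/ r = q]; apply/seteqP; split=> [v Yv|v [Xv /= H]].
  split; [exact: curve_sub | move=> r [->|->]];
    last by rewrite qE off_line_curve.
  by case/Xirr_surgery_coordP: Yv => ez _ _; rewrite pE ez addNr.
apply/Xirr_surgery_coordP; have [_ g0] := (Xirr_whitehead_coordP v).1 Xv;
  split=> //.
  by apply/eqP; rewrite -addr_eq0 -pE H //; left.
by apply/eqP; rewrite -subr_eq0 -/(off_line v) -qE H //; right.
Qed.

Lemma subvariety_curve : subvariety X Y.
Proof. by split; [exact: closed_in_curve | exact: irreducible_curve]. Qed.

Lemma closed_in_refl Z : closed_in Z Z.
Proof. by exists set0; apply/seteqP; split=> [v Zv|v []//]; split. Qed.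

Lemma closed_in_subset Z A : closed_in Z A -> A `<=` Z.
Proof. by move=> [S ->] v []. Qed.

(** An irreducible set on which a product vanishes lies in the zero locus of one
    of the factors. *)
Lemma irreducible_prod Z (s : seq F) : irreducible_set Z ->
  (forall w, Z w -> \prod_(r <- s) (cx w - r) = 0) ->
  exists r, forall w, Z w -> cx w = r.
Proof.
move=> [[v Zv] irr]; elim: s => [/(_ v Zv)/eqP|r s IH H].
  by rewrite big_nil oner_eq0.
have [p pE] : polyfun (fun w : pt => cx w - r) by rewrite /cx; polyfun.
have [q qE] : polyfun (fun w : pt => \prod_(r <- s) (cx w - r)).
  elim: (s) => [|r' s' [q qE]].
    by exists 1 => w; rewrite big_nil /ev meval1.
  have [q' q'E] : polyfun (fun w : pt => (cx w - r') * ev q w).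
    by rewrite /cx; polyfun.
  by exists q' => w; rewrite big_cons q'E qE.
have cl (f : {mpoly F[3]}) : closed_in Z (Z `&` [set w | ev f w = 0]).
  exists [set f]; apply/seteqP; split=> [w [Zw /= f0]|w [Zw /= H0]]; split=>
    //=.
    by move=> _ ->.
  exact: H0.
have [|pZ|qZ] := irr _ _ (cl p) (cl q).
- move=> w Zw; have /eqP := H w Zw; rewrite big_cons mulf_eq0.
  by case/orP=> /eqP e; [left | right]; split; rewrite //= ?pE ?qE.
- by exists r => w /pZ[_ /=]; rewrite pE => /eqP; rewrite subr_eq0 => /eqP.
by apply: IH => w /qZ[_ /=]; rewrite qE.
Qed.

(** A proper closed subset of the curve lies in the zero set of a nonzero
    polynomial in x, which splits into linear factors. *)
Lemma proper_subvariety_point Z :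
  subvariety Y Z -> Z <> Y -> exists v, Z = [set v].
Proof.
move=> [cZ iZ] nZ; have ZY := closed_in_subset cZ.
have [v [Yv nZv]] : exists v, Y v /\ ~ Z v.
  apply: contrapT => nex; apply: nZ; apply/seteqP; split=> // v Yv.
  by apply: contrapT => nZv; apply: nex; exists v.
have [p [pv pZ]] := closed_in_separate cZ Yv nZv.
have [q qE] := ev_line p.
have q0 : q != 0.
  by apply: contraNneq pv => q0; rewrite (line_cx Yv) -qE q0 horner0.
have [s qs] := closed_field_poly_normal q.
have [|r rE] := @irreducible_prod Z s iZ.
  move=> w Zw; have /eqP := pZ _ Zw; rewrite (line_cx (ZY _ Zw)) -qE qs hornerZ.
  rewrite mulf_eq0 lead_coef_eq0 (negPf q0) /= horner_prod => /eqP.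
  by under eq_bigr do rewrite hornerXsubC; rewrite -(line_cx (ZY _ Zw)).
exists (line r); apply/seteqP; split=> [w Zw|w ->];
  first by rewrite /= (line_cx (ZY _ Zw)) rE.
by have [[u Zu] _] := iZ; rewrite -(rE u Zu) -(line_cx (ZY _ Zu)).
Qed.

(** In a chain of three subvarieties the middle one is a proper subvariety,
    hence a point, which leaves no room below it. *)
Lemma dimension_curve : has_dimension Y 1.
Proof.
split.
  exists (fun i => if i == 0 then [set line 0] else Y); split=> [i|i j ij].
    case: ifP => _; last first.
      by split; [exact: closed_in_refl | exact: irreducible_curve].
    split.
      have [p pE] : polyfun (fun w : pt => cx w) by rewrite /cx; polyfun.
      exists [set p]; apply/seteqP; split=> [v ->|v [Yv /= /(_ p erefl)]].
        by split; [exact: curve_line0 | move=> _ ->; rewrite pE /line pt3E].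
      by rewrite pE => e; rewrite (line_cx Yv) e.
    split; first by exists (line 0).
    move=> A B _ _ AB; have [a|b] := AB (line 0) erefl; [left | right];
      by move=> _ ->.
  have -> : i = 0.
    by apply: val_inj => /=; move: ij; case: j i => [[|[|//]] ?] [[|[|//]] ?].
  have -> : (j == 0) = false by case: eqP ij => // ->.
  rewrite eqxx; split; first by move=> _ ->; apply: curve_line0.
  move=> e; have := curve_line1 F; rewrite -e => /(congr1 (@cx F)).
  by rewrite /line !pt3E => /eqP; rewrite oner_eq0.
move=> e c [sub strict]; rewrite leqNgt; apply/negP => e1.
have e2 : (2 < e.+1)%N by [].
pose i0 : 'I_e.+1 := ord0.
pose i1 : 'I_e.+1 := Ordinal (ltnW e2); pose i2 : 'I_e.+1 := Ordinal e2.
have [s01 n01] := strict i0 i1 erefl; have [s12 n12] := strict i1 i2 erefl.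
have [|v cv] := proper_subvariety_point (sub i1).
  move=> e1Y; apply: n12; apply/seteqP; split=> //.
  by rewrite e1Y; apply: (closed_in_subset (sub i2).1).
have [_ [[w cw] _]] := sub i0; apply: n01; apply/seteqP; split=> // u.
rewrite cv => /= ->; have := s01 _ cw; rewrite cv => /= <-; exact: cw.
Qed.

Lemma torsion_function_exists : exists tau, torsion_function F tau.
Proof.
exists (@torsion_at F); split.
  have [p pE] : polyfun (@torsion_at F).
    by rewrite /torsion_at /torsion_poly /cx /cy /cz; polyfun.
  move=> v Xv; exists p, 1; rewrite /ev meval1 oner_neq0; split=> // w _ _.
  by rewrite -/(ev p w) pE meval1 divr1.
move=> rho rep irr acy t tv; left.
have f0 := (whitehead_irrepP rep.1 irr).1 rep.
have g0 := (irreducible_repP rep.1).1 irr.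
by rewrite char_ptE /torsion_at !pt3E (whitehead_torsionE rep f0 g0 acy tv).
Qed.

Lemma is_divisor_tau tau :
  torsion_function F tau -> is_divisor X tau << 2%:Z *g Y >>.
Proof.
move=> tauP Z; rewrite tau_zeros //.
have compY : irreducible_component Y Y.
  split; first by split; [exact: closed_in_refl | exact: irreducible_curve].
  by move=> C [cC _] YC; apply/seteqP; split=> //; apply: closed_in_subset cC.
split=> [[[cZ iZ] maxZ]|nZ]; last first.
  rewrite coeffU; case: eqP => [e|_]; last by rewrite mulr0.
  by case: nZ; rewrite -e.
have -> : Z = Y by apply/esym/maxZ; [exact: compY.1 | exact: closed_in_subset].
by exists 2; [exact: tau_order | rewrite coeffU eqxx mulr1].
Qed.

End Curve.

Theorem theorem1p1 (R : realType) :
  let X := Xirr R[i] whitehead in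
  let Y := Xirr R[i] (whitehead_surgery (-3) 1 (-3) 1) in
  [/\ subvariety X Y,
      has_dimension Y 1,
      exists tau, torsion_function R[i] tau
    & forall tau, torsion_function R[i] tau ->
        is_divisor X tau << 2%:Z *g Y >>].
Proof.
split.
- exact: subvariety_curve.
- exact: dimension_curve.
- exact: torsion_function_exists.
- by move=> tau; apply: is_divisor_tau.
Qed.
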